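(* There exist a Banach space $X$ and an operator $T\in L(X)$ such that $B_T$ is chaotic on $\ell^p(X,\mathbb{Z})$ for every $1<p<\infty$ and on $c_0(X,\mathbb{Z})$, but $T$ is not chaotic on $X$.
   Context: $L(X)$ denotes the bounded linear operators on $X$. $\ell^p(X,\mathbb{Z})$ is the Banach space of families $(x_k)_{k\in\mathbb{Z}}$ in $X$ with $\sum_k\|x_k\|^p<\infty$ (with the $\ell^p$-norm), and $c_0(X,\mathbb{Z})$ is the Banach space of families $(x_k)_{k\in\mathbb{Z}}$ in $X$ with $\lim_{|k|\to\infty}\|x_k\|=0$ (with the sup norm). $B_T$ is the bounded operator $B_T(x_k)_{k\in\mathbb{Z}}=(Tx_{k+1})_{k\in\mathbb{Z}}$. An operator $S$ on a Banach space $Y$ is chaotic if it is hypercyclic (some $y\in Y$ has dense orbit $\{S^ny:n\ge 0\}$) and its set of periodic points (those $y$ with $S^dy=y$ for some $d\ge1$) is dense in $Y$. *)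

(* Defs.v *)
From HB Require Import structures.
From mathcomp Require Import all_boot all_order all_algebra finmap.
From mathcomp Require Import all_classical all_reals all_analysis.
From mathcomp Require Import unstable ring lra zify.
From mathcomp.real_closed Require Import complex.

Set Implicit Arguments.
Unset Strict Implicit.
Unset Printing Implicit Defensive.

Import Order.TTheory GRing.Theory Num.Theory.
Import numFieldNormedType.Exports.

Local Open Scope classical_set_scope.
Local Open Scope ring_scope.

(* Banach spaces are over the real or the complex numbers. *)
Variant scalar_kind := RealScalars | ComplexScalars.

Definition scalar_field (R : realType) (s : scalar_kind) : numFieldType :=
  match s with RealScalars => R | ComplexScalars => R[i] end.

Definition of_real (R : realType) (s : scalar_kind) : R -> scalar_field R s :=
  match s with
  | RealScalars => id
  | ComplexScalars => fun r => (r%:C)%C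
  end.
Arguments of_real {R} s r.

Definition re (R : realType) (s : scalar_kind) : scalar_field R s -> R :=
  match s with
  | RealScalars => id
  | ComplexScalars => fun z => complex.Re z
  end.
Arguments re {R s} a.

Section Scalars.
Variables (R : realType) (s : scalar_kind).
Implicit Types (r : R) (a : scalar_field R s).

Lemma of_real_le r r' : (of_real s r <= of_real s r') = (r <= r').
Proof. by case: s => //=; exact: lecR. Qed.

Lemma of_real_lt r r' : (of_real s r < of_real s r') = (r < r').
Proof. by case: s => //=; exact: ltcR. Qed.

Lemma of_realD r r' : of_real s (r + r') = of_real s r + of_real s r'.
Proof. by case: s => //=; exact: raddfD. Qed.

Lemma of_realM r r' : of_real s (r * r') = of_real s r * of_real s r'.
Proof. by case: s => //=; exact: rmorphM. Qed.

Lemma of_real0 : of_real s 0 = 0 :> scalar_field R s.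
Proof. by case: s. Qed.

Lemma of_real1 : of_real s 1 = 1 :> scalar_field R s.
Proof. by case: s. Qed.

Lemma of_realK r : re (of_real s r) = r.
Proof. by case: s. Qed.

Lemma reK a : 0 <= a -> of_real s (re a) = a.
Proof.
case: s a => //= -[x y]; rewrite lecE /= => /andP[/eqP -> _] //.
Qed.

Lemma re_norm a : of_real s (re `|a|) = `|a|.
Proof. exact: reK. Qed.

End Scalars.

Lemma esum_le_fset (R : realType) (T : choiceType) (a : T -> R) (c : R) :
  (\esum_(k in [set: T]) (a k)%:E <= c%:E)%E <->
  forall J : {fset T}, \sum_(k <- J) a k <= c.
Proof.
split=> [h J|h].
  rewrite -lee_fin (le_trans _ h)//; apply: esum_ge; exists [set` J] => //.
  rewrite fsbig_finite//= set_fsetK sumEFin //.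
apply: ge_ereal_sup => _ [X [finX _] <-].
by rewrite fsbig_finite//= sumEFin lee_fin.
Qed.

Section RealNorm.
Variables (R : realType) (s : scalar_kind) (X : normedModType (scalar_field R s)).
Implicit Types (x y : X) (a : scalar_field R s).

(* The norm of a normed module over K takes its values in K; rnorm is that
   norm seen as a real number. *)
Definition rnorm x : R := re `|x|.

Lemma of_real_rnorm x : of_real s (rnorm x) = `|x|.
Proof. exact: reK. Qed.

Lemma rnorm_ge0 x : 0 <= rnorm x.
Proof. by rewrite -(of_real_le s) of_real_rnorm of_real0. Qed.

Lemma rnorm_le x r : (rnorm x <= r) = (`|x| <= of_real s r).
Proof. by rewrite -of_real_rnorm of_real_le. Qed.

Lemma rnorm_lt x r : (rnorm x < r) = (`|x| < of_real s r).
Proof. by rewrite -of_real_rnorm of_real_lt. Qed.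

Lemma rnormD x y : rnorm (x + y) <= rnorm x + rnorm y.
Proof. by rewrite rnorm_le of_realD !of_real_rnorm ler_normD. Qed.

Lemma rnormZ a x : rnorm (a *: x) = re `|a| * rnorm x.
Proof.
rewrite -[LHS](of_realK s) of_real_rnorm normrZ -(re_norm a).
by rewrite -of_real_rnorm -of_realM !of_realK.
Qed.

Lemma rnorm0 : rnorm 0 = 0.
Proof. by rewrite /rnorm normr0 -(of_real0 R s) of_realK. Qed.

Lemma rnorm_eq0 x : rnorm x = 0 -> x = 0.
Proof.
by move=> h; apply/eqP; rewrite -normr_eq0 -of_real_rnorm h of_real0.
Qed.

Lemma rnormN x : rnorm (- x) = rnorm x.
Proof. by rewrite /rnorm normrN. Qed.

End RealNorm.

Lemma re_ge0 (R : realType) (s : scalar_kind) (a : scalar_field R s) :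
  0 <= a -> 0 <= re a.
Proof. by move=> a0; rewrite -(of_real_le s) reK// of_real0. Qed.

(* A normed space Y of families in X, whose norm is described by the bounds
   `G x c` ("the norm of x is at most c"), is complete as soon as it is closed
   under uniform-in-G limits and G is stable under pointwise limits. *)
Lemma family_complete (R : realType) (s : scalar_kind)
    (X : completeNormedModType (scalar_field R s)) (Y : normedModType (scalar_field R s))
    (f : {linear Y -> (int -> X)}) (G : (int -> X) -> R -> Prop) :
  (forall y c, 0 <= c -> (`|y| <= of_real s c <-> G (f y) c)) ->
  (forall u c k, G u c -> rnorm (u k) <= c) ->
  (forall u c, (forall (J : {fset int}) e, 0 < e ->
      exists2 v, G v c & forall k, k \in J -> rnorm (u k - v k) < e) ->
    G u c) ->
  (forall u, (forall e, 0 < e -> exists y, G (u - f y) e) ->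
    exists y, f y = u) ->
  forall F : set_system Y, ProperFilter F -> cauchy F -> cvg F.
Proof.
move=> GN Gk Glim Gcl F FF Fc.
have Fc' (e : R) : 0 < e -> exists2 A, F A &
    forall y z, A y -> A z -> G (f y - f z) e.
  move=> e0; have e0' : 0 < of_real s (e / 2).
    by rewrite -of_real0 of_real_lt divr_gt0.
  have [y Fy] := (cauchyP F).1 Fc _ e0'.
  exists (ball y (of_real s (e / 2))) => // u v yu yv.
  rewrite -linearB; apply/(GN _ _ (ltW e0)).
  rewrite [e]splitr of_realD (le_trans (ler_distD y _ _))// lerD//.
    by move: yu; rewrite -ball_normE /= distrC => yu; apply: ltW.
  by move: yv; rewrite -ball_normE /= => yv; apply: ltW.
have /choice[u Fu] : forall k, exists u : X, (f y k) @[y --> F] --> u.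
  move=> k; apply/cvg_ex; apply/cauchy_cvgP/cauchy_exP => e e0.
  have re0 : 0 < re e / 2.
    by rewrite divr_gt0// -(of_real_lt s) of_real0 reK ?ltW.
  have [A FA HA] := Fc' _ re0; have [y Ay] := filter_ex FA.
  exists (f y k); suff : F [set z | ball (f y k) e (f z k)] by [].
  apply: filterS FA => z Az; rewrite -ball_normE /= -(reK (ltW e0)) -rnorm_lt.
  have h : rnorm ((f y - f z) k) <= re e / 2 by apply: Gk; exact: HA.
  by apply: (le_lt_trans h); lra.
have GF e : 0 < e -> exists2 A, F A & forall y, A y -> G (u - f y) e.
  move=> e0; have [A FA HA] := Fc' _ e0; exists A => // y Ay.
  apply: Glim => J d d0.
  have : \forall z \near F, forall k, k \in J -> rnorm (u k - f z k) < d.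
    have : F (\bigcap_(k in [set` J]) [set z | rnorm (u k - f z k) < d]).
      apply: filter_bigI => k kJ /=.
      have /cvgrPdist_lt := Fu k; move=> /(_ (of_real s d)).
      rewrite -of_real0 of_real_lt => /(_ d0).
      by apply: filterS => z; rewrite /= rnorm_lt.
    by apply: filterS => z zJ k kJ; exact: zJ.
  move=> FJ; have [z [Az zJ]] := filter_ex (filterI FA FJ).
  exists (f z - f y); first exact: HA.
  by move=> k kJ; rewrite /= opprB addrA subrK; exact: zJ.
have [|y fy] := Gcl u.
  move=> e e0; have [A FA HA] := GF _ e0; have [y Ay] := filter_ex FA.
  by exists y; exact: HA.
apply/cvg_ex; exists y; apply/cvgrPdist_le => e e0.
have [|A FA HA] := GF (re e); first by rewrite -(of_real_lt s) of_real0 reK ?ltW.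
apply: filterS FA => z Az; rewrite -(reK (ltW e0)); apply/(GN _ _ (re_ge0 (ltW e0))).
by rewrite linearB fy; exact: HA.
Qed.

Section PowerSums.
Variables (R : realType) (p : R).
Hypothesis p1 : 1 <= p.

Let p_gt0 : 0 < p. Proof. exact: lt_le_trans p1. Qed.

Lemma powR_root (c : R) : 0 <= c -> (c `^ p) `^ p^-1 = c.
Proof. by move=> c0; rewrite -powRrM divff ?gt_eqF// powRr1. Qed.

Lemma root_powR (c : R) : 0 <= c -> (c `^ p^-1) `^ p = c.
Proof. by move=> c0; rewrite -powRrM mulVf ?gt_eqF// powRr1. Qed.

Lemma root_le (t c : R) : 0 <= t -> 0 <= c -> (t `^ p^-1 <= c) = (t <= c `^ p).
Proof.
move=> t0 c0; apply/idP/idP => h.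
  rewrite -(root_powR t0); apply: ge0_ler_powR => //; first exact: ltW.
  by rewrite nnegrE powR_ge0.
rewrite -(powR_root c0); apply: ge0_ler_powR => //; last by rewrite nnegrE powR_ge0.
by rewrite invr_ge0 ltW.
Qed.

Lemma powR_sum_le (u v a b : R) : 0 <= u -> 0 <= v -> 0 < a -> 0 < b ->
  (u + v) `^ p <=
  (a + b) `^ p / (a + b) * (a * (u `^ p / a `^ p) + b * (v `^ p / b `^ p)).
Proof.
move=> u0 v0 a0 b0; have ab0 : 0 < a + b by rewrite addr_gt0.
have t0 : 0 <= a / (a + b) by rewrite divr_ge0 ?ltW.
have t1 : a / (a + b) <= 1 by rewrite ler_pdivrMr// mul1r lerDl ltW.
have tC : 1 - a / (a + b) = b / (a + b).
  by apply: (mulIf (lt0r_neq0 ab0)); rewrite mulrBl !divfK ?gt_eqF//; ring.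
have := convex_powR p1 (Itv01 t0 t1).
move=> /(_ (u / a) (v / b)); rewrite !inE/= !in_itv/= !andbT.
move=> /(_ (divr_ge0 u0 (ltW a0)) (divr_ge0 v0 (ltW b0))).
rewrite [X in X `^ _ <= _ -> _]convRE [X in _ <= X -> _]convRE /= /onem tC.
have -> : a / (a + b) * (u / a) + b / (a + b) * (v / b) = (u + v) / (a + b).
  by field; rewrite !gt_eqF.
have VM x y : 0 <= x -> 0 < y -> (x / y) `^ p = x `^ p / y `^ p.
  move=> x0 y0; rewrite powRM ?invr_ge0 ?(ltW y0)//; congr (_ * _).
  by rewrite -(powR_inv1 (ltW y0)) -powRrM mulN1r powRN.
rewrite !VM ?addr_ge0// ler_pdivrMr ?powR_gt0// => /le_trans; apply.
by rewrite le_eqVlt; apply/orP; left; apply/eqP; ring.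
Qed.

End PowerSums.

Section Lp.
Variables (R : realType) (s : scalar_kind).
Variable X : completeNormedModType (scalar_field R s).
Variable p : R.
Hypothesis p1 : 1 <= p.
Implicit Types (x y : int -> X) (J : {fset int}) (c d : R).

Let p_gt0 : 0 < p. Proof. exact: lt_le_trans p1. Qed.

Definition lp_sum x : \bar R := \esum_(k in [set: int]) (rnorm (x k) `^ p)%:E.

Definition lp_pred of 1 <= p : {pred int -> X} := fun x => (lp_sum x < +oo)%E.

Definition lp_norm x : R := fine (lp_sum x) `^ p^-1.

Definition lp_bound x c : Prop :=
  0 <= c /\ forall J, (\sum_(k <- J) rnorm (x k) `^ p) `^ p^-1 <= c.

Let sum_ge0 x J : 0 <= \sum_(k <- J) rnorm (x k) `^ p.
Proof. by apply: sumr_ge0 => k _; exact: powR_ge0. Qed.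

Lemma lp_sum_ge0 x : (0 <= lp_sum x)%E.
Proof. by apply: esum_ge0 => k _; rewrite lee_fin powR_ge0. Qed.

Lemma lp_boundP x c : 0 <= c -> lp_bound x c <-> (lp_sum x <= (c `^ p)%:E)%E.
Proof.
move=> c0; split=> [[_ h]|/esum_le_fset h].
  by apply/esum_le_fset => J; rewrite -root_le.
by split=> // J; rewrite root_le.
Qed.

Lemma lp_bound_mem x c : lp_bound x c -> x \in lp_pred p1.
Proof.
move=> h; have [c0 _] := h; move/(lp_boundP _ c0): h => /le_lt_trans; apply.
exact: ltry.
Qed.

Lemma lp_norm_ge0 x : 0 <= lp_norm x. Proof. exact: powR_ge0. Qed.

Lemma lp_norm_le x c : x \in lp_pred p1 -> 0 <= c ->
  (lp_norm x <= c <-> lp_bound x c).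
Proof.
move=> xp c0; rewrite lp_boundP// /lp_norm root_le ?fine_ge0 ?lp_sum_ge0//.
by rewrite -lee_fin fineK// ge0_fin_numE ?lp_sum_ge0.
Qed.

Lemma lp_norm_bound x : x \in lp_pred p1 -> lp_bound x (lp_norm x).
Proof. by move=> xp; apply/lp_norm_le => //; exact: lp_norm_ge0. Qed.

Lemma lp_bound_coord x c k : lp_bound x c -> rnorm (x k) <= c.
Proof.
move=> [c0 /(_ [fset k]%fset)]; rewrite big_seq_fset1.
by rewrite powR_root ?rnorm_ge0.
Qed.

Lemma lp_root_leD x y J c d : 0 <= c -> 0 <= d ->
  (\sum_(k <- J) rnorm (x k) `^ p) `^ p^-1 <= c ->
  (\sum_(k <- J) rnorm (y k) `^ p) `^ p^-1 <= d ->
  (\sum_(k <- J) rnorm (x k + y k) `^ p) `^ p^-1 <= c + d.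
Proof.
move=> c0 d0 xc yd; apply/ler_addgt0Pr => e e0.
pose a := c + e / 2; pose b := d + e / 2.
have e20 : 0 < e / 2 by rewrite divr_gt0.
have a0 : 0 < a by rewrite ltr_wpDl.
have b0 : 0 < b by rewrite ltr_wpDl.
have -> : c + d + e = a + b by rewrite /a /b addrACA -splitr.
have ab0 : 0 < a + b by rewrite addr_gt0.
have {}xc : \sum_(k <- J) rnorm (x k) `^ p <= a `^ p.
  by rewrite -root_le ?sum_ge0 ?(ltW a0)// (le_trans xc)// lerDl ltW.
have {}yd : \sum_(k <- J) rnorm (y k) `^ p <= b `^ p.
  by rewrite -root_le ?sum_ge0 ?(ltW b0)// (le_trans yd)// lerDl ltW.
rewrite root_le ?(sum_ge0 (x + y)) ?(ltW ab0)//.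
have h k : rnorm (x k + y k) `^ p <= (a + b) `^ p / (a + b) *
   (a * (rnorm (x k) `^ p / a `^ p) + b * (rnorm (y k) `^ p / b `^ p)).
  apply: le_trans (powR_sum_le p1 (rnorm_ge0 _) (rnorm_ge0 _) a0 b0).
  by apply: ge0_ler_powR; rewrite ?(ltW p_gt0)// ?nnegrE ?addr_ge0 ?rnorm_ge0 ?rnormD.
apply: (le_trans (ler_sum _ (fun k _ => h k))).
rewrite -mulr_sumr big_split/= -!mulr_sumr -!mulr_suml.
apply: (@le_trans _ _ ((a + b) `^ p / (a + b) * (a + b))); last first.
  by rewrite divfK ?gt_eqF.
rewrite ler_wpM2l ?divr_ge0 ?powR_ge0 ?(ltW ab0)// lerD//.
  by rewrite ger_pMr// ler_pdivrMr ?powR_gt0// mul1r.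
by rewrite ger_pMr// ler_pdivrMr ?powR_gt0// mul1r.
Qed.

Lemma lp_boundD x y c d : lp_bound x c -> lp_bound y d ->
  lp_bound (x + y) (c + d).
Proof.
move=> [c0 xc] [d0 yd]; split; first exact: addr_ge0.
by move=> J; exact: lp_root_leD.
Qed.

Lemma lp_bound_dom x y (h : int -> int) m c : injective h -> 0 <= m ->
  (forall k, rnorm (y k) <= m * rnorm (x (h k))) ->
  lp_bound x c -> lp_bound y (m * c).
Proof.
move=> hI m0 yx [c0 xc]; split; first exact: mulr_ge0.
move=> J; rewrite root_le ?mulr_ge0// powRM//.
have /(_ [fset h k | k in J]%fset) := xc.
rewrite root_le// big_imfset/=; last by move=> i j _ _; exact: hI.
move=> hx; apply: (@le_trans _ _ (m `^ p * \sum_(k <- J) rnorm (x (h k)) `^ p)).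
  rewrite mulr_sumr; apply: ler_sum => k _.
  rewrite -powRM ?rnorm_ge0//; apply: ge0_ler_powR; rewrite ?(ltW p_gt0)//.
    by rewrite nnegrE rnorm_ge0.
  by rewrite nnegrE mulr_ge0 ?rnorm_ge0.
by rewrite ler_wpM2l ?powR_ge0.
Qed.

Lemma lp_boundZ x a c : lp_bound x c -> lp_bound (a *: x) (re `|a| * c).
Proof.
apply: (@lp_bound_dom _ _ id) => // [|k]; first exact/re_ge0/normr_ge0.
by rewrite -rnormZ.
Qed.

Lemma lp_bound_lim u c :
  (forall J e, 0 < e ->
    exists2 v, lp_bound v c & forall k, k \in J -> rnorm (u k - v k) < e) ->
  lp_bound u c.
Proof.
move=> h; have c0 : 0 <= c by have [v []] := h fset0 1 ltr01.
split=> // J; apply/ler_addgt0Pr => e e0.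
pose n := (size J).+1.
have n0 : 0 < n%:R :> R by rewrite ltr0n.
have [|v [_ vc] uv] := h J (e / n%:R); first by rewrite divr_gt0.
have -> : \sum_(k <- J) rnorm (u k) `^ p =
          \sum_(k <- J) rnorm (v k + (u - v) k) `^ p.
  by apply: eq_bigr => k _; rewrite !fctE addrCA subrr addr0.
apply: lp_root_leD => //; [exact: ltW|].
rewrite root_le ?(ltW e0)//.
apply: (@le_trans _ _ (\sum_(k <- J) (e / n%:R) `^ p)).
  rewrite big_seq [leRHS]big_seq; apply: ler_sum => k kJ.
  apply: ge0_ler_powR; rewrite ?(ltW p_gt0)// ?nnegrE ?rnorm_ge0//.
    by rewrite divr_ge0 ?(ltW e0).
  by apply: ltW; exact: uv.
rewrite big_const_seq iter_addr_0 count_predT.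
have -> : e `^ p = (n%:R `^ p) * (e / n%:R) `^ p.
  by rewrite -powRM ?divr_ge0 ?(ltW e0)// mulrC divfK ?gt_eqF.
rewrite -[X in X <= _]mulr_natl ler_wpM2r ?powR_ge0//.
apply: (@le_trans _ _ n%:R); first by rewrite ler_nat.
by apply: le1r_powR => //; rewrite ler1n.
Qed.

Lemma lp_submod_closed : submod_closed (lp_pred p1).
Proof.
split=> [|a x y xp yp].
  apply: (@lp_bound_mem _ 0); split=> // J.
  rewrite big1 ?powR0 ?invr_eq0 ?gt_eqF// => k _.
  by rewrite rnorm0 powR0// gt_eqF.
apply: (@lp_bound_mem _ (re `|a| * lp_norm x + lp_norm y)).
by apply: lp_boundD; [apply: lp_boundZ|]; exact: lp_norm_bound.
Qed.

HB.instance Definition _ := GRing.isSubmodClosed.Build _ _ (lp_pred p1)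
  lp_submod_closed.

Record lp := Lp { lp_val :> int -> X; lp_valP : lp_val \in lp_pred p1 }.

HB.instance Definition _ := [isSub for lp_val].
HB.instance Definition _ := [Choice of lp by <:].
HB.instance Definition _ := [SubChoice_isSubLmodule of lp by <:].

Let norm (x : lp) : scalar_field R s := of_real s (lp_norm x).

Let norm_le (x : lp) c : 0 <= c -> norm x <= of_real s c <-> lp_bound x c.
Proof. by move=> c0; rewrite of_real_le; exact/lp_norm_le/c0/lp_valP. Qed.

Let normD (x y : lp) : norm (x + y) <= norm x + norm y.
Proof.
rewrite -of_realD; apply/norm_le; first by rewrite addr_ge0 ?lp_norm_ge0.
by apply: lp_boundD; exact/lp_norm_bound/lp_valP.
Qed.

Let normZ_le (a : scalar_field R s) (x : lp) : norm (a *: x) <= `|a| * norm x.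
Proof.
rewrite -(re_norm a) -of_realM; apply/norm_le.
  by rewrite mulr_ge0 ?lp_norm_ge0 ?re_ge0.
exact/lp_boundZ/lp_norm_bound/lp_valP.
Qed.

Let normZ (a : scalar_field R s) (x : lp) : norm (a *: x) = `|a| * norm x.
Proof.
have [->|a0] := eqVneq a 0.
  apply/eqP; rewrite eq_le normZ_le normr0 mul0r -of_real0 of_real_le.
  exact: lp_norm_ge0.
apply/eqP; rewrite eq_le normZ_le /= -ler_pdivlMl ?normr_gt0// -normfV.
by rewrite -{1}[x](scalerK a0) normZ_le.
Qed.

Let norm_eq0 (x : lp) : norm x = 0 -> x = 0.
Proof.
move=> x0; apply/val_inj/funext => k; apply: rnorm_eq0.
apply/eqP; rewrite eq_le rnorm_ge0 andbT; apply: lp_bound_coord.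
by apply/norm_le; rewrite // x0 of_real0.
Qed.

HB.instance Definition _ :=
  Lmodule_isNormed.Build (scalar_field R s) lp normD normZ norm_eq0.

Lemma lp_normE (x : lp) : `|x| = of_real s (lp_norm x). Proof. by []. Qed.

Lemma lp_complete (F : set_system lp) : ProperFilter F -> cauchy F -> cvg F.
Proof.
move: F; apply: (@family_complete _ _ _ lp (\val : {linear _ -> _}) lp_bound).
- by move=> x c; exact: norm_le.
- by move=> u c k; exact: lp_bound_coord.
- exact: lp_bound_lim.
move=> u /(_ 1 ltr01)[y uy].
have up : u \in lp_pred p1.
  rewrite -(subrK (val y) u); apply: (@lp_bound_mem _ (1 + lp_norm y)).
  by apply: lp_boundD => //; exact/lp_norm_bound/lp_valP.
by exists (Lp up).
Qed.

HB.instance Definition _ := Uniform_isComplete.Build lp lp_complete.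

End Lp.

(* The filter of the limit |k| -> oo over the integers k. *)
Definition int_infty : set_system int :=
  filter_from [set: nat] (fun N => [set k : int | (N <= `|k|)%N]).

Global Instance int_infty_filter : ProperFilter int_infty.
Proof.
apply: filter_from_proper; last by move=> N _; exists (N%:Z) => /=.
apply: filter_from_filter; first by exists 0%N.
move=> M N _ _; exists (maxn M N) => // k /=.
by rewrite geq_max => /andP[].
Qed.

Section C0.
Variables (R : realType) (s : scalar_kind).
Variable X : completeNormedModType (scalar_field R s).
Implicit Types (x y : int -> X) (c d : R).

Definition c0_pred : {pred int -> X} :=
  fun x => `[< `|x k| @[k --> int_infty] --> (0 : scalar_field R s) >].

Definition c0_norm x : R := sup (range (fun k => rnorm (x k))).

Lemma c0P x : x \in c0_pred <-> forall e, 0 < e ->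
  exists N : nat, forall k : int, (N <= `|k|)%N -> rnorm (x k) < e.
Proof.
split=> [/asboolP/cvgrPdist_lt h e e0|h].
  have /h[N _ hN] : 0 < of_real s e by rewrite -of_real0 of_real_lt.
  by exists N => k /hN; rewrite /= sub0r normrN normr_id rnorm_lt.
apply/asboolP/cvgrPdist_lt => e e0.
have [|N hN] := h (re e); first by rewrite -(of_real_lt s) of_real0 reK ?ltW.
exists N => // k /= /hN; rewrite sub0r normrN normr_id rnorm_lt reK//.
exact: ltW.
Qed.

Definition c0_bound x c : Prop := forall k, rnorm (x k) <= c.

Lemma c0_bounded x : x \in c0_pred -> exists c, c0_bound x c.
Proof.
move=> /c0P/(_ 1 ltr01)[N hN].
pose S := \sum_(i < N) (rnorm (x i%:Z) + rnorm (x (- i%:Z))).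
have S0 : 0 <= S by apply: sumr_ge0 => i _; rewrite addr_ge0 ?rnorm_ge0.
exists (S + 1) => k; have [/hN/ltW kN|kN] := leqP N `|k|%N.
  by rewrite (le_trans kN)// lerDr.
apply: (@le_trans _ _ S); last by rewrite lerDl.
rewrite /S (bigD1 (Ordinal kN))//= -[leLHS]addr0 lerD//; last first.
  by apply: sumr_ge0 => i _; rewrite addr_ge0 ?rnorm_ge0.
have [kE|kE] : k = `|k|%N%:Z \/ k = - `|k|%N%:Z by lia.
  by rewrite [X in rnorm (x X) <= _]kE lerDl rnorm_ge0.
by rewrite [X in rnorm (x X) <= _]kE lerDr rnorm_ge0.
Qed.

Lemma c0_norm_le x c : x \in c0_pred -> (c0_norm x <= c <-> c0_bound x c).
Proof.
move=> /c0_bounded[d xd]; split=> [h k|h].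
  apply: le_trans h; apply: ub_le_sup; last by exists k.
  by exists d => _ [i _ <-].
by apply: ge_sup => [|_ [k _ <-]//]; exists (rnorm (x 0)); exists 0.
Qed.

Lemma c0_norm_bound x : x \in c0_pred -> c0_bound x (c0_norm x).
Proof. by move=> xc; exact/c0_norm_le. Qed.

Lemma c0_boundD x y c d : c0_bound x c -> c0_bound y d ->
  c0_bound (x + y) (c + d).
Proof. by move=> xc yd k; rewrite (le_trans (rnormD _ _))// lerD. Qed.

Lemma c0_boundZ x a c : c0_bound x c -> c0_bound (a *: x) (re `|a| * c).
Proof. by move=> xc k; rewrite rnormZ ler_wpM2l// re_ge0. Qed.

Lemma c0_submod_closed : submod_closed c0_pred.
Proof.
split=> [|a x y /c0P xc /c0P yc].
  by apply/c0P => e e0; exists 0%N => k _; rewrite rnorm0.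
apply/c0P => e e0.
have a0 : 0 < re `|a| + 1 by rewrite ltr_wpDl ?re_ge0.
have [|M hM] := xc (e / 2 / (re `|a| + 1)); first by rewrite !divr_gt0.
have [|N hN] := yc (e / 2); first by rewrite divr_gt0.
exists (maxn M N) => k; rewrite geq_max => /andP[/hM xk /hN yk].
rewrite (le_lt_trans (rnormD _ _))// [ltRHS]splitr ler_ltD//.
rewrite [leLHS]rnormZ; move: xk; rewrite ltr_pdivlMr// => /ltW; apply: le_trans.
by rewrite mulrC ler_wpM2l ?rnorm_ge0// lerDl.
Qed.

HB.instance Definition _ := GRing.isSubmodClosed.Build _ _ c0_pred
  c0_submod_closed.

Record c0 := C0 { c0_val :> int -> X; c0_valP : c0_val \in c0_pred }.

HB.instance Definition _ := [isSub for c0_val].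
HB.instance Definition _ := [Choice of c0 by <:].
HB.instance Definition _ := [SubChoice_isSubLmodule of c0 by <:].

Let norm (x : c0) : scalar_field R s := of_real s (c0_norm x).

Let norm_le (x : c0) c : norm x <= of_real s c <-> c0_bound x c.
Proof. by rewrite of_real_le; exact/c0_norm_le/c0_valP. Qed.

Let normD (x y : c0) : norm (x + y) <= norm x + norm y.
Proof.
rewrite -of_realD; apply/norm_le.
by apply: c0_boundD; exact/c0_norm_bound/c0_valP.
Qed.

Let normZ_le (a : scalar_field R s) (x : c0) : norm (a *: x) <= `|a| * norm x.
Proof.
rewrite -(re_norm a) -of_realM; apply/norm_le.
exact/c0_boundZ/c0_norm_bound/c0_valP.
Qed.

Let norm_ge0 (x : c0) : 0 <= c0_norm x.
Proof.
exact: le_trans (rnorm_ge0 _) (c0_norm_bound (c0_valP x) 0).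
Qed.

Let normZ (a : scalar_field R s) (x : c0) : norm (a *: x) = `|a| * norm x.
Proof.
have [->|a0] := eqVneq a 0.
  apply/eqP; rewrite eq_le normZ_le normr0 mul0r -of_real0 of_real_le.
  exact: norm_ge0.
apply/eqP; rewrite eq_le normZ_le /= -ler_pdivlMl ?normr_gt0// -normfV.
by rewrite -{1}[x](scalerK a0) normZ_le.
Qed.

Let norm_eq0 (x : c0) : norm x = 0 -> x = 0.
Proof.
move=> x0; apply/val_inj/funext => k; apply: rnorm_eq0.
apply/eqP; rewrite eq_le rnorm_ge0 andbT.
have : c0_bound x 0 by apply/norm_le; rewrite x0 of_real0.
exact.
Qed.

HB.instance Definition _ :=
  Lmodule_isNormed.Build (scalar_field R s) c0 normD normZ norm_eq0.

Lemma c0_normE (x : c0) : `|x| = of_real s (c0_norm x). Proof. by []. Qed.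

Lemma c0_complete (F : set_system c0) : ProperFilter F -> cauchy F -> cvg F.
Proof.
move: F; apply: (@family_complete _ _ _ c0 (\val : {linear _ -> _}) c0_bound).
- by move=> x c _; exact: norm_le.
- by move=> u c k; exact.
- move=> u c h k; apply/ler_addgt0Pr => e e0.
  have [v vc /(_ k)] := h [fset k]%fset _ e0.
  rewrite inE eqxx => /(_ isT)/ltW uv.
  by rewrite -(subrK (v k) (u k)) (le_trans (rnormD _ _))// addrC lerD.
move=> u h; have uc : u \in c0_pred.
  apply/c0P => e e0; have e20 : 0 < e / 2 by rewrite divr_gt0.
  have [y uy] := h _ e20; have /c0P/(_ _ e20)[N hN] := c0_valP y.
  exists N => k /hN yk; rewrite -(subrK (y k) (u k)).
  by rewrite (le_lt_trans (rnormD _ _))// [ltRHS]splitr ler_ltD//; exact: uy.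
by exists (C0 uc).
Qed.

HB.instance Definition _ := Uniform_isComplete.Build c0 c0_complete.

End C0.

Record bounded_operator (R : realType) (s : scalar_kind)
    (Y : completeNormedModType (scalar_field R s)) := BoundedOperator {
  operator_fun :> {linear Y -> Y};
  operator_bounded : bounded_near operator_fun (nbhs (0 : Y)) }.

Lemma operator_rbound (R : realType) (s : scalar_kind)
    (Y : completeNormedModType (scalar_field R s)) (T : bounded_operator Y) :
  exists2 m : R, 0 <= m & forall y, rnorm (T y) <= m * rnorm y.
Proof.
have /linear_boundedP/pinfty_ex_gt0[m m0 hm] := operator_bounded T.
exists (re m); first by rewrite re_ge0 ?ltW.
move=> y; rewrite rnorm_le of_realM of_real_rnorm reK ?(ltW m0)//.

Qed.

Lemma operator_bounded_of (R : realType) (s : scalar_kind)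
    (Y : completeNormedModType (scalar_field R s)) (T : {linear Y -> Y}) (m : R) :
  (forall y, `|T y| <= of_real s m * `|y|) -> bounded_near T (nbhs (0 : Y)).
Proof.
move=> Tm; apply/linear_boundedP; near=> r => y.
apply: (le_trans (Tm y)); rewrite ler_wpM2r//; near: r.
apply: nbhs_pinfty_ge.
by rewrite realE -of_real0 !of_real_le -realE num_real.
Unshelve. all: by end_near. Qed.

Section OperatorShift.
Variables (R : realType) (s : scalar_kind).
Variables (X : completeNormedModType (scalar_field R s)) (T : bounded_operator X).
Implicit Types (x : int -> X).

(* The operator B_T on families. *)
Definition shift_fun x : int -> X := fun k => T (x (k + 1)).

Lemma shift_fun_linear a x y :
  shift_fun (a *: x + y) = a *: shift_fun x + shift_fun y.
Proof. by apply/funext => k; rewrite /shift_fun linearP. Qed.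

Section LpShift.
Variables (p : R) (p1 : 1 <= p).

Lemma lp_bound_shift : exists2 m : R, 0 <= m &
  forall x c, lp_bound p x c -> lp_bound p (shift_fun x) (m * c).
Proof.
have [m m0 Tm] := operator_rbound T; exists m => // x c.
apply: (@lp_bound_dom _ _ _ _ p1 x _ (fun k => k + 1)) => // [|k].
  exact: (@addIr _ 1).
exact: Tm.
Qed.

Lemma shift_lp_subproof (x : lp X p1) : shift_fun x \in lp_pred p1.
Proof.
have [m m0 hm] := lp_bound_shift.
exact/lp_bound_mem/hm/lp_norm_bound/lp_valP.
Qed.

Definition shift_lp_fun (x : lp X p1) : lp X p1 := Lp (shift_lp_subproof x).

Lemma shift_lp_linear : linear shift_lp_fun.
Proof. by move=> a x y; apply/val_inj/shift_fun_linear. Qed.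

HB.instance Definition _ :=
  GRing.isLinear.Build _ _ _ _ shift_lp_fun shift_lp_linear.

Lemma shift_lp_bounded : bounded_near shift_lp_fun (nbhs (0 : lp X p1)).
Proof.
have [m m0 hm] := lp_bound_shift; apply: (@operator_bounded_of _ _ _ _ m) => x.
rewrite !lp_normE -of_realM of_real_le; apply/(lp_norm_le (lp_valP _)).
  by rewrite mulr_ge0 ?lp_norm_ge0.
exact/hm/lp_norm_bound/lp_valP.
Qed.

Definition shift_lp : bounded_operator (lp X p1) :=
  BoundedOperator shift_lp_bounded.

End LpShift.

Lemma c0_bound_shift : exists2 m : R, 0 <= m &
  forall x c, c0_bound x c -> c0_bound (shift_fun x) (m * c).
Proof.
have [m m0 Tm] := operator_rbound T; exists m => // x c xc k.
by rewrite (le_trans (Tm _))// ler_wpM2l.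
Qed.

Lemma shift_c0_subproof (x : c0 X) : shift_fun x \in @c0_pred _ _ X.
Proof.
have [m m0 Tm] := operator_rbound T; apply/c0P => e e0.
have m1 : 0 < m + 1 by rewrite ltr_wpDl.
have [|N hN] := (c0P x).1 (c0_valP x) (e / (m + 1)); first by rewrite divr_gt0.
exists N.+1 => k kN; have {}/hN : (N <= `|(k + 1)%R|)%N by lia.
rewrite ltr_pdivlMr//; apply: le_lt_trans; rewrite (le_trans (Tm _))//.
by rewrite mulrC ler_wpM2l ?rnorm_ge0// lerDl.
Qed.

Definition shift_c0_fun (x : c0 X) : c0 X := C0 (shift_c0_subproof x).

Lemma shift_c0_linear : linear shift_c0_fun.
Proof. by move=> a x y; apply/val_inj/shift_fun_linear. Qed.

HB.instance Definition _ :=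
  GRing.isLinear.Build _ _ _ _ shift_c0_fun shift_c0_linear.

Lemma shift_c0_bounded : bounded_near shift_c0_fun (nbhs (0 : c0 X)).
Proof.
have [m m0 hm] := c0_bound_shift; apply: (@operator_bounded_of _ _ _ _ m) => x.
rewrite !c0_normE -of_realM of_real_le; apply/(c0_norm_le _ (c0_valP _)).
exact/hm/c0_norm_bound/c0_valP.
Qed.

Definition shift_c0 : bounded_operator (c0 X) :=
  BoundedOperator shift_c0_bounded.

End OperatorShift.

Section Chaos.
Variables (R : realType) (s : scalar_kind).
Variables (Y : completeNormedModType (scalar_field R s)) (S : bounded_operator Y).

Definition hypercyclic : Prop :=
  exists y : Y, dense [set iter n S y | n in [set: nat]].

Definition periodic_points : set Y :=
  [set y | exists d : nat, (1 <= d)%N /\ iter d S y = y].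

Definition chaotic : Prop := hypercyclic /\ dense periodic_points.

End Chaos.

(* Main.v *)
(* Let v_n = |n| + 1 and let T be the weighted backward shift on X = l^1(Z) with
   T e_n = (v_n / v_(n-1)) e_(n-1), so that T^m e_n = (v_n / v_(n-m)) e_(n-m) for
   all integers m, a vector of norm O(1/|m|). A vector of l^p(X, Z) or c_0(X, Z)
   with the single entry e_n at the index k thus lies on a bi-infinite orbit of
   B_T which tends to 0 in both directions, and since B_T^m moves that entry to
   the index k - m, the terms of this orbit with d | m sum to a periodic point as
   soon as (1/(|m|+1))_m is in the space: this holds for c_0 and for l^p with
   p > 1. On X itself, a point x with T^d x = x has v_(n+jd) x_(n+jd) = v_n x_n
   for all j, and the harmonic series diverges, so x = 0. *)
From HB Require Import structures.
Require Import Defs.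
From mathcomp Require Import all_boot all_order all_algebra finmap.
From mathcomp Require Import all_classical all_reals all_analysis.
From mathcomp Require Import ring lra zify.
From mathcomp.real_closed Require Import complex.

Set Implicit Arguments.
Unset Strict Implicit.
Unset Printing Implicit Defensive.

Import Order.TTheory GRing.Theory Num.Theory.
Import numFieldNormedType.Exports.

Local Open Scope classical_set_scope.
Local Open Scope ring_scope.

(** * The scalar field *)

Lemma norm_complex_le (R : realType) (z : R[i]) :
  (`|z| <= (`|complex.Re z| + `|complex.Im z|)%:C)%C.
Proof.
case: z => x y; rewrite normc_def /= lecR.
rewrite -(ler_pXn2r (n := 2)) ?nnegrE ?sqrtr_ge0 ?addr_ge0//.
rewrite sqr_sqrtr ?addr_ge0 ?sqr_ge0// sqrrD !real_normK ?num_real//.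
by rewrite lerD2r lerDl mulrn_wge0// mulr_ge0.
Qed.

Lemma norm_Im_le (R : realType) (z : R[i]) : ((`|complex.Im z|)%:C <= `|z|)%C.
Proof.
case: z => x y; rewrite normc_def /= lecR.
rewrite -(ler_pXn2r (n := 2)) ?nnegrE ?sqrtr_ge0//.
by rewrite sqr_sqrtr ?addr_ge0 ?sqr_ge0// real_normK ?num_real// lerDr sqr_ge0.
Qed.

(** Real and imaginary parts are 1-Lipschitz, so both converge in the complete field of reals; the
    limits reassemble because [|z|] is at most [|Re z| + |Im z|]. *)
Lemma complex_complete (R : realType) (F : set_system R[i]^o) :
  ProperFilter F -> cauchy F -> cvg F.
Proof.
move=> FF Fc.
have part (g : R[i] -> R) : (forall z w, g (z - w) = g z - g w) ->
    (forall z, ((`|g z|)%:C <= `|z|)%C) -> exists l : R^o, g z @[z --> F] --> l.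
  move=> gB g_le; 
  apply/cvg_ex; apply/cauchy_cvgP/cauchy_exP => e e0.
  have e0' : (0 : R[i]) < (e%:C)%C by rewrite ltcR.
  have [z Fz] := (cauchyP F).1 Fc _ e0'.
  exists (g z); suff : F [set w | ball (g z) e (g w)] by [].
  apply: filterS Fz => w; rewrite -!ball_normE /= => zw.
  by rewrite -ltcR -gB (le_lt_trans (g_le _)).
have [a Fa] : exists a : R^o, complex.Re z @[z --> F] --> a.
  by apply: part; [case=> ? ? [? ?] | exact: normc_ge_Re].
have [b Fb] : exists b : R^o, complex.Im z @[z --> F] --> b.
  by apply: part; [case=> ? ? [? ?] | exact: norm_Im_le].
apply/cvg_ex; exists (a +i* b)%C; apply/cvgrPdist_lt => e e0.
have eE : e = ((complex.Re e)%:C)%C.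
  by move: e0; case: e => x y; rewrite ltcE /= => /andP[/eqP-> _].
have e20 : 0 < complex.Re e / 2 by rewrite divr_gt0// -ltcR -eE.
move/cvgrPdist_lt : Fa => /(_ _ e20); move/cvgrPdist_lt : Fb => /(_ _ e20).
apply: filterS2 => -[x y] /= yb xa.
rewrite (le_lt_trans (norm_complex_le _))// eE ltcR [ltRHS]splitr ltrD//.
Qed.

(* An alias: on the regular module itself, the structure declared below would be
   shadowed by the one declared for the reals. *)
Definition scalars (R : realType) (s : scalar_kind) : Type := (scalar_field R s)^o.

HB.instance Definition _ R s :=
  NormedModule.copy (scalars R s) (scalar_field R s)^o.

Lemma scalars_complete (R : realType) (s : scalar_kind)
  (F : set_system (scalars R s)) : ProperFilter F -> cauchy F -> cvg F.
Proof.
case: s F => F; last exact: complex_complete.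
exact: (@cauchy_cvg R^o).
Qed.

HB.instance Definition _ R s :=
  Uniform_isComplete.Build (scalars R s) (@scalars_complete R s).

Lemma rnorm_scalars (R : realType) (s : scalar_kind) (r : R) :
  0 <= r -> rnorm (of_real s r : scalars R s) = r.
Proof.
move=> r0; rewrite /rnorm ger0_norm ?of_realK//.
by rewrite -(of_real0 R s) of_real_le.
Qed.

Lemma dense_ratr (R : realType) (x e : R) : 0 < e ->
  exists q : rat, `|x - ratr q| < e.
Proof.
move=> e0; have := @dense_rat R (ball x e).
case=> [||y [xy [q _ qy]]]; [by exists x; exact: ballxx | exact: ball_open |].
by exists q; move: xy; rewrite qy -ball_normE.
Qed.

(** Rational points, or pairs of rationals in the complex case, are enumerated by [unpickle];
    invalid codes default to 0. *)
Lemma scalars_separable (R : realType) (s : scalar_kind) :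
  exists q : nat -> scalars R s, forall a e, 0 < e ->
    exists i, rnorm (a - q i) < e.
Proof.
case: s.
  exists (fun i : nat => ratr (odflt (0 : rat) (choice.unpickle i))) => a e e0.
  have [q aq] := dense_ratr a e0; exists (choice.pickle q).
  by rewrite choice.pickleK.
exists (fun i : nat => let q := odflt (0 : rat, 0 : rat) (choice.unpickle i) in
  (ratr q.1 +i* ratr q.2)%C : R[i]) => -[x y] e e0.
have e20 : 0 < e / 2 by rewrite divr_gt0.
have [q xq] := dense_ratr x e20; have [r yr] := dense_ratr y e20.
exists (choice.pickle (q, r)); rewrite choice.pickleK rnorm_lt.
apply: le_lt_trans (norm_complex_le _) _.
by rewrite ltcR [ltRHS]splitr ltrD.
Qed.

(** * Families of type l^p and c_0 *)

Lemma ler_sum_subset (R : numDomainType) (T : eqType) (a : T -> R) (r t : seq T) :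
  (forall k, 0 <= a k) -> uniq r -> {subset r <= t} ->
  \sum_(k <- r) a k <= \sum_(k <- t) a k.
Proof.
move=> a0; elim: r t => [|x r IH] t /=; first by rewrite big_nil sumr_ge0.
move=> /andP[xr ur] rt.
have /perm_to_rem xt : x \in t by apply: rt; rewrite mem_head.
rewrite (perm_big _ xt) !big_cons lerD2l; apply: IH => // y yr.
have := rt y; rewrite in_cons yr orbT (perm_mem xt) in_cons => /(_ isT).
by case/orP=> // /eqP yx; rewrite -yx yr in xr.
Qed.

(* Cauchy condensation: the terms with 2^m <= i + 1 < 2^(m+1) sum to at most
   (2^(1-p))^m. *)
Lemma sum_inv_powR (R : realType) (p : R) : 1 < p ->
  exists c : R, forall J : {fset nat}, \sum_(i <- J) (i.+1%:R^-1) `^ p <= c.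
Proof.
move=> p1; have p0 : 0 < p by lra.
pose t : R := 2 `^ (1 - p); have t0 : 0 <= t by exact: powR_ge0.
have t1 : t < 1.
  have : (1 : R) `^ (p - 1) < 2 `^ (p - 1) by apply: gt0_ltr_powR; rewrite ?nnegrE; lra.
  have -> : t = (2 `^ (p - 1))^-1 by rewrite -powRN opprB.
  by rewrite powR1 invf_lt1 ?powR_gt0.
exists (1 - t)^-1 => J.
have dyadic m : \sum_(0 <= i < (2 ^ m).-1) (i.+1%:R^-1) `^ p <= \sum_(k < m) t ^+ k.
  elim: m => [|m IH]; first by rewrite big_geq // big_ord0.
  rewrite big_ord_recr /= (@big_cat_nat _ _ _ (2 ^ m).-1)//=; last first.
    by rewrite -ltnS !prednK ?expn_gt0// leq_exp2l.
  apply: lerD => //.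
  apply: (@le_trans _ _ (\sum_((2 ^ m).-1 <= i < (2 ^ m.+1).-1) ((2 ^ m)%:R^-1) `^ p)).
    apply: ler_sum_nat => i /andP[mi _].
    apply: ge0_ler_powR; rewrite ?nnegrE ?invr_ge0 ?(ltW p0)//.
    rewrite lef_pV2 ?posrE ?ltr0n ?expn_gt0// ler_nat.
    by move: mi; rewrite -ltnS prednK ?expn_gt0.
  rewrite sumr_const_nat.
  have -> : ((2 ^ m.+1).-1 - (2 ^ m).-1)%N = (2 ^ m)%N.
    by rewrite expnS; have := expn_gt0 2 m; lia.
  rewrite -[leLHS]mulr_natl natrX.
  have -> : ((2 ^+ m)^-1 : R) `^ p = (2 `^ (- p)) ^+ m.
    rewrite -powR_inv1 ?exprn_ge0// -!powR_mulrn ?powR_ge0// -!powRrM.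
    by congr (_ `^ _); ring.
  rewrite -exprMn /t powRD ?pnatr_eq0 ?implybT// powRr1//.
(* A crude strict bound on the elements of [J]; as [m < 2 ^ m], all of [J] lies in the first [m]
   dyadic blocks. *)
pose m := (\sum_(i <- J) i.+1)%N.
have Jm i : i \in J -> (i < m)%N.
  by move=> iJ; rewrite /m (big_fsetD1 i)//= leq_addr.
apply: (@le_trans _ _ (\sum_(0 <= i < (2 ^ m).-1) (i.+1%:R^-1 : R) `^ p)).
  apply: ler_sum_subset => [i||i iJ]; [exact: powR_ge0|exact: fset_uniq|].
  rewrite mem_index_iota /=.
  by have := Jm _ iJ; have := ltn_expl m (isT : 1 < 2)%N; lia.
apply: (le_trans (dyadic m)).
rewrite -(ler_pM2l (x := 1 - t)) ?subr_gt0// divff ?gt_eqF ?subr_gt0//.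
have -> : (1 - t) * \sum_(k < m) t ^+ k = 1 - t ^+ m.
  by rewrite -opprB mulNr -subrX1 opprB.
by rewrite gerBl exprn_ge0.
Qed.

Section LpFamilies.
Variables (R : realType) (s : scalar_kind) (X : completeNormedModType (scalar_field R s)).
Implicit Types (p c e : R) (u : int -> X).

(** Take a finite [J0] whose sum is within the p-th power of [e] of the supremum of all finite sums.
    Finite sets beyond [N] are disjoint from [J0], so their sums fit into the remaining gap. *)
Lemma lp_bound_tail p u c e : 1 <= p -> lp_bound p u c -> 0 < e ->
  exists N : nat, lp_bound p (fun k => if (N <= `|k|)%N then u k else 0) e.
Proof.
move=> p1 [c0 uc] e0; have p0 : 0 < p by lra.
pose a k := rnorm (u k) `^ p; have a0 k : 0 <= a k by exact: powR_ge0.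
pose A := range (fun J : {fset int} => \sum_(k <- J) a k).
have Asup : has_sup A.
  split; first by exists (\sum_(k <- fset0) a k); exists fset0.
  exists (c `^ p) => _ [J _ <-].
  by have := uc J; rewrite root_le//; apply: sumr_ge0 => k _; exact: powR_ge0.
have ep0 : 0 < e `^ p by exact: powR_gt0.
have [_ [J0 _ <-] J0A] := sup_adherent ep0 Asup.
pose N := (\sum_(k <- J0) `|k|.+1)%N.
have NJ0 k : k \in J0 -> (`|k| < N)%N.
  by move=> kJ; rewrite /N (big_fsetD1 k)//= leq_addr.
exists N; split; first exact: ltW.
move=> J; rewrite root_le ?(ltW e0)//; last first.
  by apply: sumr_ge0 => k _; exact: powR_ge0.
pose r := [seq k <- enum_fset J | (N <= `|k|)%N].
have -> : \sum_(k <- J) rnorm (if (N <= `|k|)%N then u k else 0) `^ p =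
    \sum_(k <- r) a k.
  rewrite big_filter [RHS]big_mkcond/=; apply: eq_bigr => k _.
  by case: ifP => // _; rewrite rnorm0 powR0// gt_eqF.
pose K := [fset k in r ++ enum_fset J0]%fset.
have rK : \sum_(k <- r) a k + \sum_(k <- J0) a k <= \sum_(k <- K) a k.
  rewrite -big_cat/=; apply: ler_sum_subset => //.
    rewrite cat_uniq filter_uniq ?fset_uniq//= andbT.
    apply/hasPn => k /= /NJ0 kN; rewrite mem_filter leqNgt kN //.
  by move=> k kr; apply/imfsetP; exists k.
have : \sum_(k <- K) a k <= sup A.
  by apply: ub_le_sup; [exact: Asup.2|exists K].
rewrite -/A in J0A; lra.
Qed.

Lemma lp_bound_inv p (x0 : X) : 1 < p ->
  exists c, lp_bound p (fun k : int => of_real s (`|k|.+1%:R^-1) *: x0) c.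
Proof.
move=> p1; have p0 : 0 < p by lra.
have [c hc] := sum_inv_powR p1.
have c0 : 0 <= c by have := hc fset0; rewrite big_nil.
exists (((2 * rnorm x0) `^ p * c) `^ p^-1); split; first exact: powR_ge0.
move=> J; apply: ge0_ler_powR; rewrite ?invr_ge0 ?(ltW p0) ?nnegrE//.
- by apply: sumr_ge0 => k _; exact: powR_ge0.
- by rewrite mulr_ge0 ?powR_ge0.
(* An injection of the integers into the naturals with [h k] at most [2 * |k|], whence
   [1 / (|k| + 1)] is at most [2 / (h k + 1)]: this is the factor 2 in the bound. *)
pose h (k : int) : nat := if (0 <= k)%R then (2 * `|k|)%N else (2 * `|k|).-1.
have hI : injective h by move=> i j; rewrite /h; case: ifP; case: ifP; lia.
have := hc [fset h k | k in J]%fset.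
rewrite big_imfset/=; last by move=> i j _ _; exact: hI.
move=> hJ.
apply: (@le_trans _ _ ((2 * rnorm x0) `^ p * \sum_(k <- J) ((h k).+1%:R^-1) `^ p)); last first.
  by rewrite ler_wpM2l ?powR_ge0.
rewrite mulr_sumr; apply: ler_sum => k _.
rewrite -powRM ?mulr_ge0 ?rnorm_ge0 ?invr_ge0//.
apply: ge0_ler_powR; rewrite ?(ltW p0)// ?nnegrE ?mulr_ge0 ?rnorm_ge0 ?invr_ge0//.
rewrite rnormZ ger0_norm; last by rewrite -(of_real0 R s) of_real_le invr_ge0.
rewrite of_realK -mulrA mulrCA mulrC ler_wpM2l ?rnorm_ge0//.
rewrite -lef_pV2 ?posrE ?invr_gt0 ?ltr0n ?mulr_gt0 ?invr_gt0//.
rewrite invfM !invrK -(ler_pM2l (x := 2))// mulrA divff// mul1r -natrM ler_nat.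
by rewrite /h; case: ifP; lia.
Qed.

Lemma c0_tail u e : u \in @c0_pred R s X -> 0 < e ->
  exists N : nat, c0_bound (fun k => if (N <= `|k|)%N then u k else 0) e.
Proof.
move=> /c0P h e0; have [N hN] := h _ e0; exists N => k.
by case: ifP => [/hN/ltW//|_]; rewrite rnorm0 ltW.
Qed.

Lemma c0_inv (x0 : X) :
  (fun k : int => of_real s (`|k|.+1%:R^-1) *: x0) \in @c0_pred R s X.
Proof.
apply/c0P => e e0; pose N := Num.trunc (rnorm x0 / e).
exists N => k kN.
rewrite rnormZ ger0_norm; last by rewrite -(of_real0 R s) of_real_le invr_ge0.
rewrite of_realK mulrC ltr_pdivrMr ?ltr0n// mulrC -ltr_pdivrMr//.
have /truncn_itv/andP[_ /lt_le_trans] : 0 <= rnorm x0 / e by rewrite divr_ge0 ?rnorm_ge0 ?ltW.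
by apply; rewrite ler_nat.
Qed.

End LpFamilies.

(** * A criterion for chaos *)

Lemma half_expr_small (R : realType) (e : R) : 0 < e ->
  exists N : nat, forall i, (N <= i)%N -> 2^-1 ^+ i < e.
Proof.
move=> e0; exists (Num.trunc e^-1).+1 => i Ni.
have /truncn_itv/andP[_ ei] : 0 <= e^-1 by rewrite invr_ge0 ltW.
rewrite exprVn -ltf_pV2 ?posrE ?invr_gt0 ?exprn_gt0// invrK (lt_trans ei)//.
by rewrite -natrX ltr_nat (leq_ltn_trans Ni)// ltn_expl.
Qed.

Lemma sum_half_expr (R : realType) (m : nat) : \sum_(j < m) (2^-1 : R) ^+ j <= 2.
Proof.
suff -> : \sum_(j < m) (2^-1 : R) ^+ j = 2 - 2 * 2^-1 ^+ m.
  by rewrite gerBl mulr_ge0// exprn_ge0.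
elim: m => [|m IH]; first by rewrite big_ord0 expr0; ring.
by rewrite big_ord_recr/= IH exprS; field.
Qed.

Section Criterion.
Variables (R : realType) (s : scalar_kind).
Variables (Y : completeNormedModType (scalar_field R s)) (S : bounded_operator Y).
Implicit Types (y z w : Y) (e : R).

Lemma rnorm_sum (I : Type) (r : seq I) (P : pred I) (F : I -> Y) :
  rnorm (\sum_(i <- r | P i) F i) <= \sum_(i <- r | P i) rnorm (F i).
Proof.
apply: (big_ind2 (fun y c => rnorm y <= c)) => //; first by rewrite rnorm0.
by move=> y c z d yc zd; rewrite (le_trans (rnormD _ _))// lerD.
Qed.

Lemma dense_rnorm (A : set Y) :
  (forall y e, 0 < e -> exists2 z, A z & rnorm (y - z) < e) -> dense A.
Proof.
move=> h U [y Uy] Uo.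
have /nbhs_normP[e /= e0 eU] : nbhs y U by exact: open_nbhs_nbhs.
have re0 : 0 < re e by rewrite -(of_real_lt s) of_real0 reK ?ltW.
have [z Az yz] := h y _ re0; exists z; split => //; apply: eU.
by move: yz; rewrite rnorm_lt reK ?ltW.
Qed.

Lemma rnorm_cauchy_cvg (u : nat -> Y) :
  (forall e, 0 < e -> exists N, forall m, (N <= m)%N -> rnorm (u m - u N) < e) ->
  exists l, forall e, 0 < e -> exists N, forall m, (N <= m)%N -> rnorm (l - u m) < e.
Proof.
move=> h; have [l ul] : exists l : Y, u m @[m --> \oo] --> l.
  apply/cvg_ex; apply/cauchy_cvgP/cauchy_exP => e e0.
  have re0 : 0 < re e by rewrite -(of_real_lt s) of_real0 reK ?ltW.
  have [N hN] := h _ re0; exists (u N); exists N => // m /= /hN.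
  by rewrite -ball_normE /= rnorm_lt reK ?ltW// distrC.
exists l => e e0; have e0' : 0 < of_real s e by rewrite -of_real0 of_real_lt.
move/cvgrPdist_lt : ul => /(_ _ e0')[N _ hN]; exists N => m /hN /=.
by rewrite rnorm_lt.
Qed.

Lemma iter_operatorP n a y z :
  iter n S (a *: y + z) = a *: iter n S y + iter n S z.
Proof. by elim: n => //= n ->; rewrite linearP. Qed.

Lemma iter_operator0 n : iter n S 0 = 0.
Proof. by elim: n => //= n ->; rewrite linear0. Qed.

Lemma iter_operatorD n y z : iter n S (y + z) = iter n S y + iter n S z.
Proof. by have := iter_operatorP n 1 y z; rewrite !scale1r. Qed.

Lemma iter_operatorB n y z : iter n S (y - z) = iter n S y - iter n S z.
Proof. by rewrite addrC -scaleN1r iter_operatorP scaleN1r addrC. Qed.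

Lemma iter_operator_sum n (I : Type) (r : seq I) (F : I -> Y) :
  iter n S (\sum_(i <- r) F i) = \sum_(i <- r) iter n S (F i).
Proof. exact: (big_morph _ (iter_operatorD n) (iter_operator0 n)). Qed.

Lemma iter_operator_rbound n :
  exists2 c : R, 0 <= c & forall y, rnorm (iter n S y) <= c * rnorm y.
Proof.
have [m m0 hm] := operator_rbound S.
elim: n => [|n [c c0 hc]]; first by exists 1 => // y; rewrite mul1r.
exists (m * c); first exact: mulr_ge0.
by move=> y /=; rewrite (le_trans (hm _))// -mulrA ler_wpM2l.
Qed.

(** The backward half of the orbit is chosen, since [S] need not be invertible; it supplies small
    vectors that iterates of [S] carry to [z]. *)
Definition homoclinic z := exists2 f : int -> Y, f 0 = z &
  (forall m, S (f m) = f (m + 1)) /\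
  forall e, 0 < e -> exists N : nat, forall m : int, (N <= `|m|)%N -> rnorm (f m) < e.

(** Every large period [d] is required, not just one, so that two such points can be approximated
    with a common period and added. *)
Definition nearly_periodic z := forall e, 0 < e -> exists N : nat,
  forall d, (N <= d)%N -> exists2 w, iter d S w = w & rnorm (w - z) < e.

Lemma homoclinic0 : homoclinic 0.
Proof.
exists (fun=> 0) => //; split=> [m|e e0]; first by rewrite linear0.
by exists 0%N => m _; rewrite rnorm0.
Qed.

Lemma nearly_periodic0 : nearly_periodic 0.
Proof.
move=> e e0; exists 0%N => d _; exists 0; first exact: iter_operator0.
by rewrite subr0 rnorm0.
Qed.

Lemma homoclinicP a z w : homoclinic z -> homoclinic w -> homoclinic (a *: z + w).
Proof.
move=> [f f0 [fS fv]] [g g0 [gS gv]]; exists (fun m => a *: f m + g m).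
  by rewrite f0 g0.
split=> [m|e e0]; first by rewrite linearP fS gS.
(* The added 1 keeps the divisor positive when [a] is 0. *)
have c0 : 0 < re `|a| + 1 by rewrite ltr_wpDl ?re_ge0.
have [|M hM] := fv (e / 2 / (re `|a| + 1)); first by rewrite !divr_gt0.
have [|N hN] := gv (e / 2); first by rewrite divr_gt0.
exists (maxn M N) => m; rewrite geq_max => /andP[/hM + /hN gm].
rewrite ltr_pdivlMr// => fm; rewrite (le_lt_trans (rnormD _ _))// [ltRHS]splitr.
rewrite ler_ltD// rnormZ mulrC (le_trans _ (ltW fm))// ler_wpM2l ?rnorm_ge0//.
by rewrite lerDl.
Qed.

Lemma nearly_periodicP a z w :
  nearly_periodic z -> nearly_periodic w -> nearly_periodic (a *: z + w).
Proof.
move=> zP wP e e0; have c0 : 0 < re `|a| + 1 by rewrite ltr_wpDl ?re_ge0.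
have [|M hM] := zP (e / 2 / (re `|a| + 1)); first by rewrite !divr_gt0.
have [|N hN] := wP (e / 2); first by rewrite divr_gt0.
exists (maxn M N) => d; rewrite geq_max => /andP[/hM[z' z'P z'z] /hN[w' w'P w'w]].
exists (a *: z' + w'); first by rewrite iter_operatorP z'P w'P.
move: z'z; rewrite ltr_pdivlMr// => z'z; rewrite opprD addrACA -scalerBr.
rewrite (le_lt_trans (rnormD _ _))// [ltRHS]splitr.
rewrite ler_ltD// rnormZ mulrC (le_trans _ (ltW z'z))// ler_wpM2l ?rnorm_ge0//.
by rewrite lerDl.
Qed.

(* The hypercyclic vector is [\sum_j f_j (- n_j)], where [f_j] is a homoclinic
   orbit through [z_j] and the times [n_j] are so far apart that [S^(n_i)] maps
   it close to [z_i]. *)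
Lemma homoclinic_hypercyclic (z : nat -> Y) : (forall i, homoclinic (z i)) ->
  (forall y e, 0 < e -> exists i, rnorm (y - z i) < e) -> hypercyclic S.
Proof.
move=> zh zd.
(* Each z_a occurs infinitely often in z'. *)
pose z' i := z (logn 2 i.+1).
have z'd y e K : 0 < e -> exists2 i, (K <= i)%N & rnorm (y - z' i) < e.
  move=> e0; have [a ya] := zd y e e0.
  (* Here [i.+1] is [2 ^ a] times an odd number, so its 2-adic valuation is [a], while [K] makes it
     as large as desired. *)
  exists (2 ^ a * (K.*2.+1)).-1; first by have := expn_gt0 2 a; nia.
  rewrite /z' prednK ?muln_gt0 ?expn_gt0// lognM ?expn_gt0//.
  by rewrite pfactorK// logn_coprime ?addn0// coprime2n /= odd_double.
have /choice[f hf] : forall i, exists f : int -> Y, [/\ f 0 = z' i,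
    forall m, S (f m) = f (m + 1) & forall e, 0 < e ->
    exists N : nat, forall m : int, (N <= `|m|)%N -> rnorm (f m) < e].
  by move=> i; have [f f0 [fS fv]] := zh (logn 2 i.+1); exists f.
pose q : R := 2^-1; have q0 : 0 < q by rewrite invr_gt0.
have q1 : q <= 1 by rewrite invf_le1// ler1n.
have /choice[N hN] : forall t : nat * nat, exists N : nat,
    forall m : int, (N <= `|m|)%N -> rnorm (f t.1 m) < q ^+ t.2 * q ^+ t.2.
  by move=> [l i]; have [_ _] := hf l; apply; rewrite mulr_gt0 ?exprn_gt0.
(* From distance [M i] on, all of [f 0], ..., [f i] are below [q ^+ i * q ^+ i]. The times [n j] are
   partial sums of [M], so the gap between [n j] and any earlier time is at least [M j]. *)
pose M i := (\sum_(l < i.+1) N (l : nat, i))%N.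
pose n j := (\sum_(l < j.+1) M l)%N.
(* Of the two factors, [q ^+ j] is summed over the orbits and [q ^+ i] makes the total small. *)
have fM i j m : (M (maxn i j) <= `|m|)%N -> rnorm (f j m) <= q ^+ i * q ^+ j.
  have ji : (j < (maxn i j).+1)%N by rewrite ltnS leq_maxr.
  move=> Mm; have /hN/ltW/le_trans : (N (j, maxn i j) <= `|m|)%N.
    by rewrite (leq_trans _ Mm)// /M (bigD1 (Ordinal ji))//= leq_addr.
  apply; rewrite /=; apply: ler_pM; rewrite ?exprn_ge0 ?(ltW q0)//.
    by rewrite ler_wiXn2l ?(ltW q0)// leq_maxl.
  by rewrite ler_wiXn2l ?(ltW q0)// leq_maxr.
have nM i j : (i < j)%N -> (n i + M j <= n j)%N.
  elim: j => // j IH; rewrite ltnS leq_eqVlt => /orP[/eqP->|/IH].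
    by rewrite {2}/n big_ord_recr.
  have -> : n j.+1 = (n j + M j.+1)%N by rewrite /n big_ord_recr.
  lia.
have fS j k m : iter k S (f j m) = f j (m + k%:Z).
  have [_ fS _] := hf j; elim: k => [|k IH]; first by rewrite addr0.
  by rewrite iterS IH fS; congr (f j _); lia.
pose x m := \sum_(j < m) f j (- (n j)%:Z).
have xq N0 m : (N0 <= m)%N -> rnorm (x m - x N0) <= q ^+ N0 * 2.
  move=> Nm; rewrite /x -!(big_mkord predT (fun j => f j (- (n j)%:Z))).
  rewrite (@big_cat_nat _ _ _ N0 0 m)//= addrAC subrr add0r.
  apply: (le_trans (rnorm_sum _ _ _)).
  apply: (@le_trans _ _ (\sum_(N0 <= j < m) q ^+ N0 * q ^+ j)).
    apply: ler_sum_nat => j /andP[Nj _]; apply: fM; rewrite (maxn_idPr Nj).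
    by rewrite abszN /n big_ord_recr /= leq_addl.
  rewrite -mulr_sumr ler_wpM2l ?exprn_ge0 ?(ltW q0)//.
  apply: le_trans (sum_half_expr R m); rewrite -(big_mkord predT (fun j => q ^+ j)).
  rewrite (@big_cat_nat _ _ _ N0 0 m)//= lerDr sumr_ge0// => j _.
  by rewrite exprn_ge0 ?ltW.
(* The term [j = i] lands exactly on [z' i]; the others sit at [n i - n j], far enough out for
   [fM]. *)
have xz i m : (i < m)%N -> rnorm (iter (n i) S (x m) - z' i) <= q ^+ i * 2.
  move=> im; rewrite /x iter_operator_sum (bigD1 (Ordinal im))//= fS addNr.
  have [-> _ _] := hf i; rewrite addrAC subrr add0r.
  apply: (le_trans (rnorm_sum _ _ _)).
  apply: (@le_trans _ _ (\sum_(j < m) q ^+ i * q ^+ j)); last first.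
    by rewrite -mulr_sumr ler_wpM2l ?exprn_ge0 ?(ltW q0)// sum_half_expr.
  rewrite [leRHS](bigD1 (Ordinal im))//= -[leLHS]add0r lerD//.
    by rewrite mulr_ge0 ?exprn_ge0 ?ltW.
  apply: ler_sum => j; rewrite -val_eqE /= => ji; rewrite fS; apply: fM.
  have [ij|ij|ij] := ltngtP i j; last by rewrite ij eqxx in ji.
    by have := nM _ _ ij; lia.
  by have := nM _ _ ij; lia.
have [y yx] : exists y, forall e, 0 < e ->
    exists K, forall m, (K <= m)%N -> rnorm (y - x m) < e.
  apply: rnorm_cauchy_cvg => e e0.
  have [K hK] := half_expr_small (divr_gt0 e0 (ltr0Sn R 1)).
  exists K => m Km; apply: (le_lt_trans (xq _ _ Km)).
  by rewrite -ltr_pdivlMr// hK.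
exists y; apply: dense_rnorm => w e e0.
have e30 : 0 < e / 3 by rewrite divr_gt0.
have [K hK] := half_expr_small (divr_gt0 e30 (ltr0Sn R 1)).
have [i Ki wi] := z'd w _ K e30; exists (iter (n i) S y); first by exists (n i).
(* The index [i] is fixed first, because the truncation [L] depends on the bound [c] for the iterate
   [n i]. *)
have [c c0 hc] := iter_operator_rbound (n i).
have [|L hL] := yx (e / 3 / (c + 1)); first by rewrite divr_gt0// ltr_wpDl.
have := hL (maxn L i.+1) (leq_maxl _ _); rewrite ltr_pdivlMr ?ltr_wpDl// => yL.
have h1 : rnorm (iter (n i) S y - iter (n i) S (x (maxn L i.+1))) < e / 3.
  rewrite -iter_operatorB (le_lt_trans (hc _))// (le_lt_trans _ yL)// mulrC.
  by rewrite ler_wpM2l ?rnorm_ge0// lerDl.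
have h2 : rnorm (iter (n i) S (x (maxn L i.+1)) - z' i) < e / 3.
  rewrite (le_lt_trans (xz _ _ (leq_maxr _ _)))// -ltr_pdivlMr//; exact: hK.
have -> : w - iter (n i) S y = (w - z' i) - (iter (n i) S (x (maxn L i.+1)) - z' i)
    - (iter (n i) S y - iter (n i) S (x (maxn L i.+1))).
  by rewrite !opprB !subrKA.
rewrite (le_lt_trans (rnormD _ _))// rnormN.
have := rnormD (w - z' i) (- (iter (n i) S (x (maxn L i.+1)) - z' i)).
rewrite rnormN; lra.
Qed.

Lemma nearly_periodic_dense (z : nat -> Y) : (forall i, nearly_periodic (z i)) ->
  (forall y e, 0 < e -> exists i, rnorm (y - z i) < e) -> dense (periodic_points S).
Proof.
move=> zP zd; apply: dense_rnorm => y e e0.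
have e20 : 0 < e / 2 by rewrite divr_gt0.
have [i yi] := zd y _ e20; have [N hN] := zP i _ e20.
(* [N.+1] instead of [N], as a period must be at least 1. *)
have [w wP wz] := hN N.+1 (leqnSn N).
exists w; first by exists N.+1.
rewrite -(subrKA (z i)) (le_lt_trans (rnormD _ _))// [ltRHS]splitr ltrD//.
by rewrite -rnormN opprB.
Qed.

End Criterion.

(** * Shifts on spaces of families *)

Definition single (Z : zmodType) (k : int) (x : Z) : int -> Z :=
  fun j => if j == k then x else 0.

Lemma sum_single (Z : zmodType) (ks : seq int) (x : int -> Z) j : uniq ks ->
  \sum_(k <- ks) single k (x k) j = if j \in ks then x j else 0.
Proof.
elim: ks => [|k ks IH] /=; first by rewrite big_nil.
case/andP=> kks /IH{}IH; rewrite big_cons IH in_cons /single.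
by have [->|jk] := eqVneq j k; rewrite ?(negbTE kks) ?addr0 ?add0r.
Qed.

(* Common properties of l^p(X, Z) and c_0(X, Z); [G u c] reads "the family u
   belongs to the space and its norm is at most c". *)
Record family_space (R : realType) (s : scalar_kind)
    (X Y : completeNormedModType (scalar_field R s))
    (f : {linear Y -> (int -> X)}) (G : (int -> X) -> R -> Prop) : Prop := {
  family_inj : injective f;
  family_norm : forall y c, 0 <= c -> (rnorm y <= c <-> G (f y) c);
  family_mem : forall u c, G u c -> exists y, f y = u;
  family_dom : forall u v m c, 0 <= m ->
    (forall k, rnorm (u k) <= m * rnorm (v k)) -> G v c -> G u (m * c);
  family_tail : forall u c e, G u c -> 0 < e ->
    exists N : nat, G (fun k => if (N <= `|k|)%N then u k else 0) e;
  family_single : forall k x, G (single k x) (rnorm x) }.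

Section LpC0FamilySpace.
Variables (R : realType) (s : scalar_kind).
Variable X : completeNormedModType (scalar_field R s).

Lemma lp_family_space (p : R) (p1 : 1 <= p) :
  family_space (\val : {linear lp X p1 -> (int -> X)}) (lp_bound p).
Proof.
split; first exact: val_inj.
- move=> y c c0; rewrite rnorm_le lp_normE of_real_le.
  exact/lp_norm_le/c0/lp_valP.
- by move=> u c /(lp_bound_mem p1) uc; exists (Lp uc).
- move=> u v m c m0 uv; apply: (@lp_bound_dom _ _ _ _ p1 v u id) => //.
- by move=> u c e; exact: lp_bound_tail.
- move=> k x; split; first exact: rnorm_ge0.
  have p0 : 0 < p by lra.
  move=> J; rewrite root_le ?rnorm_ge0//; last by apply: sumr_ge0 => j _; exact: powR_ge0.
  have -> : \sum_(j <- J) rnorm (single k x j) `^ p =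
      \sum_(j <- J) single k (rnorm x `^ p) j.
    apply: eq_bigr => j _; rewrite /single; case: eqP => // _.
    by rewrite rnorm0 powR0// gt_eqF.
  apply: (@le_trans _ _ (\sum_(j <- [:: k]) single k (rnorm x `^ p) j)).
    rewrite (bigID (mem [:: k])) /= [X in _ + X]big1 ?addr0; last first.
      by move=> j; rewrite inE /single => /negbTE ->.
    rewrite -big_filter; apply: ler_sum_subset.
    + by move=> j; rewrite /single; case: ifP => // _; exact: powR_ge0.
    + by rewrite filter_uniq ?fset_uniq.
    + by move=> j; rewrite mem_filter => /andP[].
  by rewrite big_seq1 /single eqxx.
Qed.

(** Membership is part of the bound here: unlike a finite p-sum, a finite supremum does not force
    the family into the space. *)
Lemma c0_family_space : family_space (\val : {linear c0 X -> (int -> X)})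
  (fun u c => u \in @c0_pred R s X /\ c0_bound u c).
Proof.
split; first exact: val_inj.
- move=> y c c0; rewrite rnorm_le c0_normE of_real_le.
  rewrite (c0_norm_le c (c0_valP y)); split=> [h|[]//].
  by split=> //; exact: c0_valP.
- by move=> u c [uc _]; exists (C0 uc).
- move=> u v m c m0 uv [/c0P vc vb]; split; last first.
    by move=> k; rewrite (le_trans (uv k))// ler_wpM2l.
  apply/c0P => e e0; have m1 : 0 < m + 1 by rewrite ltr_wpDl.
  have [|N hN] := vc (e / (m + 1)); first by rewrite divr_gt0.
  exists N => k /hN; rewrite ltr_pdivlMr// => /(le_lt_trans _); apply.
  by rewrite (le_trans (uv k))// mulrC ler_wpM2l ?rnorm_ge0// lerDl.
- move=> u c e [uc _] e0; have [N hN] := c0_tail uc e0; exists N; split => //.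
  apply/c0P => d d0; have [M hM] := (c0P u).1 uc _ d0.
  by exists M => k /hM ukd; case: ifP; rewrite ?rnorm0.
- move=> k x; split; last first.
    by move=> j; rewrite /single; case: ifP; rewrite ?rnorm0 ?rnorm_ge0.
  apply/c0P => e e0; exists `|k|.+1%N => j kj; rewrite /single.
  by case: eqP => [jk|]; [rewrite jk ltnn in kj|rewrite rnorm0].
Qed.

End LpC0FamilySpace.

Section FamilySpace.
Variables (R : realType) (s : scalar_kind).
Variables (X Y : completeNormedModType (scalar_field R s)).
Variables (f : {linear Y -> (int -> X)}) (G : (int -> X) -> R -> Prop).
Hypothesis fG : family_space f G.

Lemma exists_single k x : exists2 y, f y = single k x & rnorm y <= rnorm x.
Proof.
have Gx := family_single fG k x; have [y yx] := family_mem fG Gx.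
by exists y => //; apply/(family_norm fG); rewrite ?rnorm_ge0// yx.
Qed.

(** Finite sums of single entries taken from [q] are coded by finite lists of pairs, hence
    countable. They are dense: cut off the tail, then approximate the finitely many remaining
    entries. *)
Lemma family_dense (q : nat -> X) (P : Y -> Prop) :
  (forall x e, 0 < e -> exists i, rnorm (x - q i) < e) ->
  P 0 -> (forall y z, P y -> P z -> P (y + z)) ->
  (forall k i y, f y = single k (q i) -> P y) ->
  exists w : nat -> Y, (forall i, P (w i)) /\
    forall y e, 0 < e -> exists i, rnorm (y - w i) < e.
Proof.
move=> qd P0 PD Ps.
have /choice[inj hinj] : forall t : int * X, exists y : Y,
    f y = single t.1 t.2 /\ rnorm y <= rnorm t.2.
  by move=> [k x]; have [y yx yn] := exists_single k x; exists y.
pose wl (l : seq (int * nat)) := \sum_(t <- l) inj (t.1, q t.2).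
exists (fun i : nat => wl (odflt [::] (choice.unpickle i))); split.
  move=> i; apply: (big_ind P) => // t _; apply: (Ps t.1 t.2).
  by have [-> _] := hinj (t.1, q t.2).
move=> y e e0; have e20 : 0 < e / 2 by rewrite divr_gt0.
have Gy : G (f y) (rnorm y) by apply/(family_norm fG); rewrite ?rnorm_ge0.
have [N hN] := family_tail fG Gy e20.
(* The [2N - 1] integers with [|k| < N]; the truncated predecessors give the empty list for
   [N = 0]. *)
pose ks := [seq i%:Z - N.-1%:Z | i <- iota 0 (N.*2).-1].
have uks : uniq ks by rewrite map_inj_uniq ?iota_uniq// => i j; lia.
have memks j : (j \in ks) = (`|j| < N)%N.
  apply/mapP/idP => [[n]|jN]; first by rewrite mem_iota => ? ->; lia.
  by exists `|(j + N.-1%:Z)%R|%N; [rewrite mem_iota|]; lia.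
(* The successor covers an empty window and makes the total error strictly less than [e / 2]. *)
have d0 : 0 < e / 2 / (size ks).+1%:R by rewrite !divr_gt0.
have /choice[i hi] : forall k, exists i, rnorm (f y k - q i) < e / 2 / (size ks).+1%:R.
  by move=> k; exact: qd.
exists (choice.pickle [seq (k, i k) | k <- ks]); rewrite choice.pickleK /= /wl big_map /=.
rewrite -(subrKA (\sum_(k <- ks) inj (k, f y k))) [ltRHS]splitr.
rewrite (le_lt_trans (rnormD _ _))// ler_ltD//.
  apply/(family_norm fG); first exact: ltW.
  suff -> : f (y - \sum_(k <- ks) inj (k, f y k)) =
    fun k => if (N <= `|k|)%N then f y k else 0 by [].
  rewrite linearB linear_sum; apply/funext => j; rewrite fct_sumE.
  rewrite -[LHS]/(f y j - \sum_(k <- ks) f (inj (k, f y k)) j).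
  have -> : \sum_(k <- ks) f (inj (k, f y k)) j = if j \in ks then f y j else 0.
    rewrite -(sum_single _ _ uks); apply: eq_bigr => k _.
    by have [-> _] := hinj (k, f y k).
  by rewrite memks ltnNge; case: leqP; rewrite ?subr0 ?subrr.
rewrite -sumrB (le_lt_trans (rnorm_sum _ _ _))//.
apply: (@le_lt_trans _ _ (\sum_(k <- ks) e / 2 / (size ks).+1%:R)); last first.
  rewrite big_const_seq iter_addr_0 count_predT -[ltLHS]mulr_natr.
  by rewrite mulrAC ltr_pdivrMr ?ltr0n// ltr_pM2l// ltr_nat.
apply: ler_sum => k _; apply: le_trans (ltW (hi k)).
have -> : inj (k, f y k) - inj (k, q (i k)) = inj (k, f y k - q (i k)).
  apply: (family_inj fG); rewrite linearB.
  have [-> _] := hinj (k, f y k); have [-> _] := hinj (k, q (i k)).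
  have [-> _] := hinj (k, f y k - q (i k)); apply/funext => j; rewrite /single /=.
  by rewrite !fctE /=; case: ifP; rewrite ?subr0.
by have [_] := hinj (k, f y k - q (i k)).
Qed.

End FamilySpace.

(** The decay rate serves twice: it tends to 0, giving homoclinic points, and it is that of the
    reference family lying in c_0 and in l^p for [p > 1], giving periodic points. *)
Definition harmonic_orbit (R : realType) (s : scalar_kind)
    (X : completeNormedModType (scalar_field R s)) (T : bounded_operator X) (x : X) :=
  exists2 b : int -> X, b 0 = x & (forall m, T (b m) = b (m + 1)) /\
    exists2 c, 0 <= c & forall m : int, rnorm (b m) <= c / `|m|.+1%:R.

Section HarmonicOrbit.
Variables (R : realType) (s : scalar_kind).
Variables (X : completeNormedModType (scalar_field R s)) (T : bounded_operator X).

Lemma harmonic_orbit0 : harmonic_orbit T 0.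
Proof.
exists (fun=> 0) => //; split=> [m|]; first by rewrite linear0.
by exists 0 => // m; rewrite rnorm0 mul0r.
Qed.

Lemma harmonic_orbitD x y :
  harmonic_orbit T x -> harmonic_orbit T y -> harmonic_orbit T (x + y).
Proof.
move=> [b b0 [bT [c c0 bc]]] [r r0 [rT [d d0 rd]]].
exists (fun m => b m + r m); first by rewrite b0 r0.
split=> [m|]; first by rewrite linearD bT rT.
exists (c + d); first exact: addr_ge0.
by move=> m; rewrite (le_trans (rnormD _ _))// mulrDl lerD.
Qed.

End HarmonicOrbit.

Section ShiftChaos.
Variables (R : realType) (s : scalar_kind).
Variables (X Y : completeNormedModType (scalar_field R s)).
Variables (f : {linear Y -> (int -> X)}) (G : (int -> X) -> R -> Prop).
Hypothesis fG : family_space f G.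
Variables (T : bounded_operator X) (S : bounded_operator Y).
Hypothesis fS : forall y, f (S y) = shift_fun T (f y).

Lemma single_homoclinic k x y : harmonic_orbit T x -> f y = single k x ->
  homoclinic S y.
Proof.
move=> [b b0 [bT [c c0 bc]]] yx.
have /choice[w hw] : forall m : int, exists w : Y,
    f w = single (k - m) (b m) /\ rnorm w <= rnorm (b m).
  by move=> m; have [w] := exists_single fG (k - m) (b m); exists w.
exists w.
  by apply: (family_inj fG); have [-> _] := hw 0; rewrite subr0 b0 yx.
split=> [m|e e0].
  apply: (family_inj fG); rewrite fS.
  have [-> _] := hw m; have [-> _] := hw (m + 1).
  apply/funext => j; rewrite /shift_fun /single.
  have -> : (j + 1 == k - m) = (j == k - (m + 1)) by apply/eqP/eqP; lia.
  by case: ifP; rewrite ?linear0 ?bT.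
(* [c / e] is below its truncation plus 1, hence below [|m| + 1]. *)
exists (Num.trunc (c / e)) => m Nm; have [_ wm] := hw m.
rewrite (le_lt_trans wm)// (le_lt_trans (bc m))//.
rewrite ltr_pdivrMr ?ltr0n// mulrC -ltr_pdivrMr//.
have /truncn_itv/andP[_ /lt_le_trans] : 0 <= c / e by rewrite divr_ge0// ltW.
by apply; rewrite ler_nat.
Qed.

Lemma iter_shift n y j : f (iter n S y) j = iter n T (f y (j + n%:Z)).
Proof.
elim: n j => [|n IH] j; first by rewrite addr0.
by rewrite !iterS fS /shift_fun IH; congr (T (iter n T (f y _))); lia.
Qed.

Lemma single_nearly_periodic (x0 : X) C k x y : rnorm x0 = 1 ->
  G (fun j : int => of_real s (`|j|.+1%:R^-1) *: x0) C ->
  harmonic_orbit T x -> f y = single k x -> nearly_periodic S y.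
Proof.
move=> x01 GC [b b0 [bT [c c0 bc]]] yx e e0.
(* Since [|j| + 1] is at most [(|k| + 1) * (|k - j| + 1)], the factor [|k| + 1] turns decay in
   [k - j] into decay in [j]. *)
pose a := c * `|k|.+1%:R; have a0 : 0 <= a by rewrite mulr_ge0.
have a1 : 0 < a + 1 by rewrite ltr_wpDl.
have e1 : 0 < e / (a + 1) by rewrite divr_gt0.
have [N hN] := family_tail fG GC e1.
have bD m n : iter n T (b m) = b (m + n%:Z).
  elim: n => [|n IH]; first by rewrite addr0.
  by rewrite iterS IH bT; congr b; lia.
(* A nonzero multiple [k - j] of such a [d] forces [|j|] to be at least [N], so [u] differs from the
   single entry only in the tail. *)
exists (N + `|k|).+1%N => d dN.
pose u j := if (d%:Z %| k - j)%Z then b (k - j) else 0.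
have Gu : G (u - single k x) (a * (e / (a + 1))).
  apply: (family_dom fG a0 _ hN) => j; rewrite !fctE /u /single.
  have [->|jk] := eqVneq j k.
    by rewrite subrr dvdz0 b0 subrr rnorm0 mulr_ge0 ?rnorm_ge0.
  rewrite subr0; case: ifP => [dj|_]; last by rewrite rnorm0 mulr_ge0 ?rnorm_ge0.
  have dkj : (d <= `|k - j|)%N.
    by apply: dvdn_leq => //; rewrite absz_gt0 subr_eq0 eq_sym.
  rewrite ifT; last by lia.
  rewrite rnormZ x01 mulr1 ger0_norm; last by rewrite -(of_real0 R s) of_real_le invr_ge0.
  rewrite of_realK (le_trans (bc _))// /a -mulrA ler_wpM2l//.
  rewrite ler_pdivlMr ?ltr0n// mulrC ler_pdivrMr ?ltr0n// -natrM ler_nat; lia.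
have [w' w'E] := family_mem fG Gu.
exists (w' + y).
  apply: (family_inj fG); apply/funext => j; rewrite iter_shift linearD w'E yx.
  rewrite subrK /u.
  (* Moving by [d] preserves divisibility, and [d] applications of [T] take [b (k - j - d)] back to
     [b (k - j)]. *)
  have -> : (d%:Z %| k - (j + d%:Z))%Z = (d%:Z %| k - j)%Z.
    by rewrite opprD addrA rpredBr ?dvdzz.
  case: ifP => // _; last exact: iter_operator0.
  by rewrite bD; congr b; lia.
rewrite addrK; apply: (@le_lt_trans _ _ (a * (e / (a + 1)))).
  by apply/(family_norm fG); [rewrite mulr_ge0 ?(ltW e1)|rewrite w'E].
by rewrite mulrCA gtr_pMr// ltr_pdivrMr// mul1r ltrDl.
Qed.

(** Being homoclinic and being nearly periodic both pass to sums, so a dense sequence with both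
    properties arises from single entries [z i]. *)
Theorem shift_chaotic (z : nat -> X) (x0 : X) C : rnorm x0 = 1 ->
  G (fun j : int => of_real s (`|j|.+1%:R^-1) *: x0) C ->
  (forall i, harmonic_orbit T (z i)) ->
  (forall x e, 0 < e -> exists i, rnorm (x - z i) < e) ->
  chaotic S.
Proof.
move=> x01 GC zT zd.
have [|y z' [yh yp] [zh zp]|k i y yz|w [wP wd]] :=
    @family_dense _ _ _ _ _ _ fG z (fun y => homoclinic S y /\ nearly_periodic S y) zd.
- by split; [exact: homoclinic0 | exact: nearly_periodic0].
- rewrite -[y]scale1r.
  by split; [exact: homoclinicP | exact: nearly_periodicP].
- split; first exact: single_homoclinic (zT i) yz.
  exact: single_nearly_periodic GC (zT i) yz.
split; first by apply: (homoclinic_hypercyclic (z := w)) => // i; have [] := wP i.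
by apply: (nearly_periodic_dense (z := w)) => // i; have [] := wP i.
Qed.

End ShiftChaos.

(** * The harmonic weighted shift *)

Section HarmonicShift.
Variables (R : realType) (s : scalar_kind).

Definition l1 := lp (scalars R s) (lexx (1 : R)).

Let weight (n : int) : R := `|n|.+1%:R.

Let weight_gt0 n : 0 < weight n. Proof. by rewrite ltr0n. Qed.

Definition harmonic_shift_fun (x : int -> scalars R s) : int -> scalars R s :=
  fun n => of_real s (weight (n + 1) / weight n) *: x (n + 1).

Let rnorm_of_realZ r (a : scalars R s) : 0 <= r ->
  rnorm (of_real s r *: a) = r * rnorm a.
Proof.
move=> r0; rewrite rnormZ ger0_norm ?of_realK//.
by rewrite -(of_real0 R s) of_real_le.
Qed.

Lemma lp_bound_harmonic_shift x c :
  lp_bound 1 x c -> lp_bound 1 (harmonic_shift_fun x) (2 * c).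
Proof.
apply: (@lp_bound_dom _ _ _ _ (lexx 1) x _ (fun k => k + 1)) => // [|k].
  exact: (@addIr _ 1).
rewrite rnorm_of_realZ ?divr_ge0// ler_wpM2r ?rnorm_ge0//.
by rewrite ler_pdivrMr// /weight -natrM ler_nat; lia.
Qed.

Lemma harmonic_shift_subproof (x : l1) :
  harmonic_shift_fun x \in lp_pred (lexx (1 : R)).
Proof.
exact: (lp_bound_mem _ (lp_bound_harmonic_shift (lp_norm_bound (lp_valP x)))).
Qed.

Definition harmonic_shift_l1 (x : l1) : l1 := Lp (harmonic_shift_subproof x).

Lemma harmonic_shift_linear : linear harmonic_shift_l1.
Proof.
move=> a x y; apply/val_inj/funext => n.
rewrite /= /harmonic_shift_fun /= !fctE scalerDr !scalerA.
by rewrite [of_real _ _ * a]mulrC.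
Qed.

HB.instance Definition _ :=
  GRing.isLinear.Build _ _ _ _ harmonic_shift_l1 harmonic_shift_linear.

Lemma harmonic_shift_bounded : bounded_near harmonic_shift_l1 (nbhs (0 : l1)).
Proof.
apply: (@operator_bounded_of _ _ _ _ 2) => x.
rewrite !lp_normE -of_realM of_real_le; apply/(lp_norm_le (lp_valP _)).
  by rewrite mulr_ge0 ?lp_norm_ge0.
exact/lp_bound_harmonic_shift/lp_norm_bound/lp_valP.
Qed.

Definition harmonic_shift : bounded_operator l1 :=
  BoundedOperator harmonic_shift_bounded.

Let fl1 : family_space (\val : {linear l1 -> (int -> scalars R s)}) (lp_bound 1) :=
  lp_family_space _ (lexx 1).

Lemma single_harmonic_orbit n (a : scalars R s) (x : l1) :
  val x = single n a -> harmonic_orbit harmonic_shift x.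
Proof.
move=> xa; pose t m := of_real s (weight n / weight (n - m)) *: a : scalars R s.
have /choice[b hb] : forall m : int, exists y : l1,
    val y = single (n - m) (t m) /\ rnorm y <= rnorm (t m).
  by move=> m; have [y] := exists_single fl1 (n - m) (t m); exists y.
exists b.
  apply: val_inj; have [-> _] := hb 0.
  by rewrite /t subr0 divff ?gt_eqF// of_real1 scale1r xa.
split=> [m|].
  apply: val_inj; have [-> _] := hb (m + 1); have [bm _] := hb m.
  apply/funext => j; rewrite /= /harmonic_shift_fun [lp_val _]bm /single.
  have -> : (j + 1 == n - m) = (j == n - (m + 1)) by apply/eqP/eqP; lia.
  case: eqP => [->|_]; last by rewrite scaler0.
  rewrite /t scalerA -of_realM; congr (of_real s _ *: a).
  have -> : n - (m + 1) + 1 = n - m by lia.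
  by field; rewrite !gt_eqF.
(* One [weight n] is the numerator of [t m]; the other comes from [|m| + 1] being at most
   [weight n * weight (n - m)]. *)
exists (weight n * weight n * rnorm a).
  by rewrite !mulr_ge0 ?rnorm_ge0.
move=> m; have [_ bm] := hb m; rewrite (le_trans bm)//.
rewrite rnorm_of_realZ ?divr_ge0// [leRHS]mulrAC ler_wpM2r ?rnorm_ge0//.
rewrite -[leRHS]mulrA ler_wpM2l// ler_pdivlMr ?ltr0n// mulrC ler_pdivrMr//.
rewrite /weight -natrM ler_nat; nia.
Qed.

Lemma harmonic_orbit_dense : exists z : nat -> l1,
  (forall i, harmonic_orbit harmonic_shift (z i)) /\
  forall x e, 0 < e -> exists i, rnorm (x - z i) < e.
Proof.
have [q qd] := scalars_separable R s.
apply: (family_dense fl1 qd).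
- exact: harmonic_orbit0.
- by move=> y z; exact: harmonic_orbitD.
- by move=> k i y; exact: single_harmonic_orbit.
Qed.

(** The weight quotients telescope. *)
Lemma iter_harmonic_shift d (x : l1) n :
  (iter d harmonic_shift x : l1) n =
  of_real s (weight (n + d%:Z) / weight n) *: x (n + d%:Z).
Proof.
elim: d n => [|d IH] n.
  by rewrite addr0 divff ?gt_eqF// of_real1 scale1r.
rewrite iterS /= /harmonic_shift_fun IH scalerA -of_realM.
have -> : n + 1 + d%:Z = n + d.+1%:Z by lia.
by congr (of_real s _ *: _); field; rewrite !gt_eqF.
Qed.

Lemma harmonic_sum_unbounded (c : R) : exists m, c < \sum_(j < m) j.+1%:R^-1.
Proof.
apply: contrapT => /forallNP h; apply: (@dvg_harmonic R).
apply: nondecreasing_is_cvgn.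
  apply/nondecreasing_seqP => m; rewrite /series /= big_nat_recr//= lerDl.
  by rewrite invr_ge0.
exists c => _ [m _ <-]; rewrite /series /= big_mkord.
by rewrite leNgt; apply/negP/h.
Qed.

Lemma harmonic_shift_periodic (x : l1) :
  periodic_points harmonic_shift x -> x = 0.
Proof.
move=> [d [d1 xd]]; apply/val_inj/funext => n; apply: rnorm_eq0.
pose h (j : nat) : int := n + (j * d)%N%:Z.
have xj j : weight (h j) * rnorm (x (h j)) = weight n * rnorm (x n).
  have xjd : iter (j * d) harmonic_shift x = x.
    by elim: j => // j IH; rewrite mulSn iterD IH.
  have := iter_harmonic_shift (j * d) x n; rewrite xjd => ->.
  by rewrite rnorm_of_realZ ?divr_ge0// mulrA [weight n * _]mulrC divfK ?gt_eqF.
have [c xc] : exists c, lp_bound 1 (val x) c.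
  by exists (lp_norm 1 (val x)); exact/lp_norm_bound/lp_valP.
apply/eqP; rewrite eq_le rnorm_ge0 andbT leNgt; apply/negP => x0.
(* As [weight (h j)] is at most [(j + 1) * (weight n + d)], the entry at [h j] has norm at least
   [a / (j + 1)]. *)
pose a := weight n * rnorm (x n) / (weight n + d%:R).
have a0 : 0 < a by rewrite divr_gt0 ?mulr_gt0 ?addr_gt0// ltr0n.
have [m] := harmonic_sum_unbounded (c / a).
rewrite ltr_pdivrMr// => /lt_le_trans; move: xc => [c0 xc] ca.
have := xc [fset h j | j in iota 0 m]%fset.
rewrite root_le//; last by apply: sumr_ge0 => k _; exact: powR_ge0.
rewrite powRr1// leNgt => /negP; apply.
rewrite big_imfset /=; last first.
  (* The sampled indices are distinct because [d] is positive. *)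
  move=> i j _ _ /addrI/eqP; rewrite eqz_nat eqn_pmul2r// => /eqP; exact.
apply: ca; rewrite mulr_suml -(big_mkord predT (fun j => j.+1%:R^-1 * a)).
rewrite /index_iota subn0 undup_id ?iota_uniq//.
apply: ler_sum => j _; rewrite powRr1 ?rnorm_ge0//.
rewrite mulrC ler_pdivrMr ?ltr0n// -(ler_pM2l (weight_gt0 (h j))) [leRHS]mulrA xj /a.
rewrite mulrCA ler_wpM2l ?mulr_ge0 ?rnorm_ge0// ler_pdivrMr ?addr_gt0 ?ltr0n//.
by rewrite /weight -natrD -natrM ler_nat /h; nia.
Qed.

Lemma l1_unit : exists x0 : l1, rnorm x0 = 1.
Proof.
have r1 : rnorm (1 : scalars R s) = 1 by rewrite -(of_real1 R s) rnorm_scalars.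
have [y yE yn] := exists_single fl1 0 (1 : scalars R s).
exists y; apply/eqP; rewrite eq_le; rewrite r1 in yn; rewrite yn /=.
have /(lp_bound_coord (lexx _) 0) : lp_bound 1 (val y) (rnorm y).
  by apply/(family_norm fl1) => //; exact: rnorm_ge0.
by rewrite yE /single eqxx r1.
Qed.

(** Density of periodic points fails: the complement of 0 is open and nonempty but contains none. *)
Lemma harmonic_shift_not_chaotic : ~ chaotic harmonic_shift.
Proof.
move=> [_ pd]; have [x0 x01] := l1_unit.
have [||w [w0 /harmonic_shift_periodic]] := pd (~` [set 0]); last exact: w0.
  exists x0 => /= x00; have := oner_neq0 R.
  by rewrite -x01 x00 rnorm0 eqxx.
exact/closed_openC/accessible_closed_set1/hausdorff_accessible/norm_hausdorff.
Qed.

End HarmonicShift.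

Theorem proposition3p8 (R : realType) (s : scalar_kind) :
  exists (X : completeNormedModType (scalar_field R s)) (T : bounded_operator X),
    (forall (p : R) (p1 : 1 < p), chaotic (shift_lp T (ltW p1))) /\
    chaotic (shift_c0 T) /\
    ~ chaotic T.
Proof.
exists (l1 R s : completeNormedModType _), (harmonic_shift R s).
have [z [zh zd]] := harmonic_orbit_dense R s.
have [x0 x01] := l1_unit R s.
split=> [p p1|]; last split; last exact: harmonic_shift_not_chaotic.
  (* Here [p > 1] enters: the harmonic family is p-summable. *)
  have [C hC] := lp_bound_inv x0 p1.
  by apply: (shift_chaotic (lp_family_space _ (ltW p1)) _ x01 hC zh zd).
have hc := c0_inv x0; have [C hC] := c0_bounded hc.
by apply: (shift_chaotic (c0_family_space _) _ x01 (conj hc hC) zh zd).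
Qed.
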